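(* Let $0<a<\infty$, $I=(-a,a)$, and assume $q\in C^\infty(I)$. Let $\mathbf{T}$ be the linear operator acting on distributions by $$\langle\mathbf{T}u,\phi\rangle:=\langle u,\mathbf{T}^\square\phi\rangle,\qquad u\in\mathcal{D}'(I),\ \phi\in C_c^\infty(I),$$ where $$\mathbf{T}^\square\psi(x)=\psi(x)-\int_{-a}^{-|x|}K(t,x)\psi(t)\,dt+\int_{|x|}^{a}K(t,x)\psi(t)\,dt .$$ Then $\mathbf{T}:\mathcal{D}'(I)\to\mathcal{D}'(I)$ is (well defined,) continuous and invertible. Also, $\mathbf{T}$ is a transmutation operator on $\mathcal{D}'(I)$, i.e. $\left(\frac{d^2}{dx^2}-q\right)\mathbf{T}u=\mathbf{T}\frac{d^2}{dx^2}u$ in $\mathcal{D}'(I)$ for every $u\in\mathcal{D}'(I)$.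
   Context: All functions are complex valued. $\mathcal{D}'(I)$ is the space of distributions on $I$ (the dual of $C_c^\infty(I)$), with pointwise convergence: $u_n\to u$ iff $\langle u_n,\phi\rangle\to\langle u,\phi\rangle$ for all $\phi\in C_c^\infty(I)$. Derivatives are distributional and $\langle qu,\phi\rangle=\langle u,q\phi\rangle$. The kernel $K$: let $H$ be the unique continuous solution of $H(u,v)=\frac12\int_0^uq(s)\,ds+\int_0^u\int_0^vq(\alpha+\beta)H(\alpha,\beta)\,d\beta\,d\alpha$ on $\{(u,v):|u|+|v|<a\}$, and $K(x,t)=H\left(\frac{x+t}2,\frac{x-t}2\right)$ for $(x,t)\in I\times I$. On $L^1_{loc}(I)$ the operator is $\mathbf{T}u(x)=u(x)+\int_{-x}^xK(x,t)u(t)\,dt$, and $\mathbf{T}^\square$ is its transpose: $\int_I(\mathbf{T}u)\phi\,dx=\int_Iu(\mathbf{T}^\square\phi)\,dx$ for $u\in L^1_{loc}(I)$ and $\phi\in C_c(I)$. *)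

(* Defs.v *)
(* Stdlib reals with Coquelicot. *)
From Stdlib Require Export Reals.
From Coquelicot Require Export Coquelicot.

Open Scope R_scope.

(** Complex-valued functions of a real variable.  Coquelicot's [Derive] is
    real-valued only, so the derivative is taken componentwise. *)

Definition CInt (f : R -> C) (a b : R) : C :=
  RInt (V := C_R_CompleteNormedModule) f a b.

Definition CDerive (f : R -> C) (x : R) : C :=
  (Derive (fun t => Re (f t)) x, Derive (fun t => Im (f t)) x).

Definition CDerive_n (f : R -> C) (n : nat) : R -> C := Nat.iter n CDerive f.

(** [D] is meant to be an open set. *)
Definition smooth_on (D : R -> Prop) (f : R -> C) : Prop :=
  forall (n : nat) (x : R), D x ->
    ex_derive (V := C_R_NormedModule) (CDerive_n f n) x.

Definition interval (a x : R) : Prop := - a < x < a.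

(** Elements of C_c^oo(I), I = (-a,a), are represented by their extension by
    zero to the whole line. *)

Definition supported_in (r : R) (phi : R -> C) : Prop :=
  forall x : R, r < Rabs x -> phi x = RtoC 0.

Definition test (a : R) (phi : R -> C) : Prop :=
  smooth_on (fun _ => True) phi /\
  exists r : R, 0 < r < a /\ supported_in r phi.

(** A distribution on I is given by a functional of which only the values on
    test functions matter; accordingly equality in D'(I) is [deq]. *)

Definition functional := (R -> C) -> C.

Definition deq (a : R) (u v : functional) : Prop :=
  forall phi : R -> C, test a phi -> u phi = v phi.

Definition linear_on_test (a : R) (u : functional) : Prop :=
  forall (c : C) (phi psi : R -> C), test a phi -> test a psi ->
    u (fun x => (c * phi x + psi x)%C) = (c * u phi + u psi)%C.

(** Continuity for the inductive limit topology of C_c^oo(I): on test functions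
    supported in [-r,r], [u] is bounded by a constant times a C^N norm.  Here
    [M] runs over the upper bounds of the C^N norm of [phi]. *)
Definition continuous_on_test (a : R) (u : functional) : Prop :=
  forall r : R, 0 < r < a ->
  exists (A : R) (N : nat), forall (phi : R -> C) (M : R),
    test a phi -> supported_in r phi ->
    (forall (k : nat) (x : R), (k <= N)%nat -> Cmod (CDerive_n phi k x) <= M) ->
    Cmod (u phi) <= A * M.

Definition distribution (a : R) (u : functional) : Prop :=
  linear_on_test a u /\ continuous_on_test a u.

Definition dist_derive (u : functional) : functional :=
  fun phi => Copp (u (CDerive phi)).

Definition dist_mult (q : R -> C) (u : functional) : functional :=
  fun phi => u (fun x => (q x * phi x)%C).

(** Convergence in D'(I) along a filter on an arbitrary index type; sequences
    are the case [X = nat], [F = eventually]. *)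
Definition dist_lim (a : R) (X : Type) (F : (X -> Prop) -> Prop)
    (v : X -> functional) (u : functional) : Prop :=
  forall phi : R -> C, test a phi ->
    filterlim (fun i => v i phi) F
      (locally (T := C_R_NormedModule) (u phi)).

Definition linear_operator (a : R) (S : functional -> functional) : Prop :=
  (forall u, distribution a u -> distribution a (S u)) /\
  (forall u v, distribution a u -> distribution a v ->
     deq a u v -> deq a (S u) (S v)) /\
  (forall (c : C) u v, distribution a u -> distribution a v ->
     deq a (S (fun phi => (c * u phi + v phi)%C))
           (fun phi => (c * S u phi + S v phi)%C)).

Definition continuous_operator (a : R) (S : functional -> functional) : Prop :=
  forall (X : Type) (F : (X -> Prop) -> Prop), Filter F ->
  forall (v : X -> functional) (u : functional),
    (forall i, distribution a (v i)) -> distribution a u ->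
    dist_lim a X F v u -> dist_lim a X F (fun i => S (v i)) (S u).

Definition inverse_operators (a : R) (S S' : functional -> functional) : Prop :=
  forall u, distribution a u -> deq a (S' (S u)) u /\ deq a (S (S' u)) u.

(** [H] is a continuous solution, on the open square |u|+|v| < a, of the
    integral equation defining the transmutation kernel. *)
Definition is_H (a : R) (q : R -> C) (H : R -> R -> C) : Prop :=
  (forall u v : R, Rabs u + Rabs v < a ->
     continuous (U := prod_UniformSpace R_UniformSpace R_UniformSpace)
       (T := C_R_NormedModule) (fun p => H (fst p) (snd p)) (u, v)) /\
  (forall u v : R, Rabs u + Rabs v < a ->
     H u v =
       (RtoC (1 / 2) * CInt q 0 u +
        CInt (fun alpha =>
                CInt (fun beta => q (alpha + beta)%R * H alpha beta) 0 v)
             0 u)%C).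

Definition kernel (H : R -> R -> C) (x t : R) : C :=
  H ((x + t) / 2) ((x - t) / 2).

(** For |x| >= a and a test function [psi] both integrands vanish, so this is
    again the extension by zero of a function on I. *)
Definition Tsquare (a : R) (K : R -> R -> C) (psi : R -> C) (x : R) : C :=
  (psi x - CInt (fun t => K t x * psi t) (- a) (- Rabs x)
         + CInt (fun t => K t x * psi t) (Rabs x) a)%C.

Definition Tdist (a : R) (K : R -> R -> C) (u : functional) : functional :=
  fun phi => u (Tsquare a K phi).

(* Main.v *)
Require Import Defs.
From Stdlib Require Import Lra Lia FunctionalExtensionality.

(** For a function [h] on the square |u| + |v| < a put
    k_h (t, x) = h ((t+x)/2, (t-x)/2), and let V_h be the Volterra operator
    V_h f (x) = int_{|x|}^a (k_h (t,x) f(t) - k_h (-t,x) f(-t)) dt.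
    The transposed operator is 1 + V_H with H the Goursat solution, and the
    theorem is a statement about 1 + V_H on test functions: every property of
    the operator on distributions is the transpose of one of these.

    Regularity.  The integrand is odd in t, so |x| may be replaced by x in the
    lower limit and V_h f has no singularity at 0.  Differentiating the integral
    gives (lemma [volterra_cderiv])
    (V_h f)' (x) = h(0,-x) f(-x) - h(x,0) f(x) + V_{h'} f (x),
    h' = (d_u h - d_v h)/2, in which f is not differentiated.  Hence V_h gains
    one derivative, with bounds ([volterra_gain]), as soon as h is smooth.  The
    Goursat solution is smooth because it belongs to a family of functions that
    is closed under partial derivatives and consists of continuous functions
    ([jet_partials], [jet_smooth2]): a derivative of H is a combination of q, H
    and integrals of such terms.

    Inverse.  For a weight e^{-lam |x|} with lam large, V_H contracts the
    weighted sup norm by 1/2 ([volterra_contraction]), so the Neumann series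
    R = sum (-V_H)^n converges uniformly and inverts 1 + V_H on continuous
    functions supported in [-r,r].  From R f = f - V_H (R f) and the gain of one
    derivative, R f is as smooth as f, with bounds ([neumann_diff_bounded]).
    Hence R is continuous on test functions and its transpose is the inverse.

    Transmutation.  Integration by parts ([volterra_by_parts]) expresses
    V_h (f') through f by the derivative (d_u h + d_v h)/2 of the kernel in t.
    Comparing (V_H f)'' with V_H (f''), the kernels differ by -d_u d_v H, that
    is by -q(t) k_H, and the boundary terms reduce to -q f by the Goursat data
    H(0,v) = 0 and d_u H (u,0) = q(u)/2.  So
    ((1 + V_H) f)'' = (1 + V_H)(f'' - q f) ([volterra_transmutation]), which is
    the transpose of the asserted identity. *)

(** * Complex-valued calculus by components *)

Definition ccont (f : R -> C) (x : R) : Prop :=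
  continuous (fun t => Re (f t)) x /\ continuous (fun t => Im (f t)) x.

Definition cderiv (f : R -> C) (x : R) (l : C) : Prop :=
  is_derive (fun t => Re (f t)) x (Re l) /\
  is_derive (fun t => Im (f t)) x (Im l).

Definition ccont2 (f : R -> R -> C) (x y : R) : Prop :=
  continuity_2d_pt (fun u v => Re (f u v)) x y /\
  continuity_2d_pt (fun u v => Im (f u v)) x y.

Lemma C_ext (z w : C) : Re z = Re w -> Im z = Im w -> z = w.
Proof. destruct z, w; simpl; intros; subst; reflexivity. Qed.

Lemma ccont_ext_loc (f g : R -> C) (x : R) :
  locally x (fun y => g y = f y) -> ccont g x -> ccont f x.
Proof.
  intros E [H1 H2]; split.
  - apply continuous_ext_loc with (2 := H1).
    revert E; apply filter_imp; intros y ->; reflexivity.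
  - apply continuous_ext_loc with (2 := H2).
    revert E; apply filter_imp; intros y ->; reflexivity.
Qed.

Lemma ccont_plus (f g : R -> C) (x : R) :
  ccont f x -> ccont g x -> ccont (fun t => f t + g t)%C x.
Proof.
  intros [? ?] [? ?]; split; simpl.
  - apply (continuous_plus (fun t => Re (f t)) (fun t => Re (g t))); assumption.
  - apply (continuous_plus (fun t => Im (f t)) (fun t => Im (g t))); assumption.
Qed.

Lemma ccont_opp (f : R -> C) (x : R) : ccont f x -> ccont (fun t => - f t)%C x.
Proof.
  intros [? ?]; split; simpl.
  - apply (continuous_opp (fun t => Re (f t))); assumption.
  - apply (continuous_opp (fun t => Im (f t))); assumption.
Qed.

Lemma ccont_mult (f g : R -> C) (x : R) :
  ccont f x -> ccont g x -> ccont (fun t => f t * g t)%C x.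
Proof.
  intros [? ?] [? ?]; split; simpl.
  - apply (continuous_minus (fun t => Re (f t) * Re (g t))
                            (fun t => Im (f t) * Im (g t)));
      refine (continuous_mult (K := R_AbsRing) _ _ _ _ _); assumption.
  - apply (continuous_plus (fun t => Re (f t) * Im (g t))
                            (fun t => Im (f t) * Re (g t)));
      refine (continuous_mult (K := R_AbsRing) _ _ _ _ _); assumption.
Qed.

Lemma ccont_const (c : C) (x : R) : ccont (fun _ => c) x.
Proof. split; apply continuous_const. Qed.

Lemma ccont_comp (f : R -> C) (g : R -> R) (x : R) :
  continuous g x -> ccont f (g x) -> ccont (fun t => f (g t)) x.
Proof.
  intros Hg [? ?]; split.
  - apply (continuous_comp g (fun t => Re (f t))); assumption.
  - apply (continuous_comp g (fun t => Im (f t))); assumption.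
Qed.

Lemma cderiv_ccont (f : R -> C) (x : R) (l : C) : cderiv f x l -> ccont f x.
Proof.
  intros [? ?]; split; apply (ex_derive_continuous (V := R_NormedModule));
    eexists; eassumption.
Qed.

Lemma cderiv_ext_loc (f g : R -> C) (x : R) (l : C) :
  locally x (fun y => g y = f y) -> cderiv g x l -> cderiv f x l.
Proof.
  intros E [H1 H2]; split.
  - apply is_derive_ext_loc with (2 := H1).
    revert E; apply filter_imp; intros y ->; reflexivity.
  - apply is_derive_ext_loc with (2 := H2).
    revert E; apply filter_imp; intros y ->; reflexivity.
Qed.

Lemma cderiv_const (c : C) (x : R) : cderiv (fun _ => c) x 0.
Proof. split; apply (is_derive_const (V := R_NormedModule)). Qed.

Lemma cderiv_plus (f g : R -> C) (x : R) (l m : C) :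
  cderiv f x l -> cderiv g x m -> cderiv (fun t => f t + g t)%C x (l + m).
Proof.
  intros [? ?] [? ?]; split; simpl.
  - apply (is_derive_plus (fun t => Re (f t)) (fun t => Re (g t))); assumption.
  - apply (is_derive_plus (fun t => Im (f t)) (fun t => Im (g t))); assumption.
Qed.

Lemma cderiv_opp (f : R -> C) (x : R) (l : C) :
  cderiv f x l -> cderiv (fun t => - f t)%C x (- l).
Proof.
  intros [? ?]; split; simpl.
  - apply (is_derive_opp (fun t => Re (f t))); assumption.
  - apply (is_derive_opp (fun t => Im (f t))); assumption.
Qed.

Lemma cderiv_minus (f g : R -> C) (x : R) (l m : C) :
  cderiv f x l -> cderiv g x m -> cderiv (fun t => f t - g t)%C x (l - m).
Proof. intros; apply cderiv_plus; [|apply cderiv_opp]; assumption. Qed.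

Lemma is_derive_eq (f : R -> R) (x l m : R) : is_derive f x l -> l = m -> is_derive f x m.
Proof. intros H <-; exact H. Qed.

Lemma cderiv_eq (f : R -> C) (x : R) (l m : C) : cderiv f x l -> l = m -> cderiv f x m.
Proof. intros H <-; exact H. Qed.

Lemma is_derive_Rmult (f g : R -> R) (x l m : R) :
  is_derive f x l -> is_derive g x m ->
  is_derive (fun t => f t * g t) x (l * g x + f x * m).
Proof.
  intros Hf Hg. apply (is_derive_mult f g x l m Hf Hg). intros; apply Rmult_comm.
Qed.

Lemma cderiv_mult (f g : R -> C) (x : R) (l m : C) :
  cderiv f x l -> cderiv g x m ->
  cderiv (fun t => f t * g t)%C x (l * g x + f x * m).
Proof.
  intros [? ?] [? ?]; split; simpl.
  - eapply is_derive_eq.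
    + apply (is_derive_minus (fun t => Re (f t) * Re (g t))
                             (fun t => Im (f t) * Im (g t)));
      apply is_derive_Rmult; eassumption.
    + unfold minus, plus, opp, Re, Im; simpl; ring.
  - eapply is_derive_eq.
    + apply (is_derive_plus (fun t => Re (f t) * Im (g t))
                             (fun t => Im (f t) * Re (g t)));
      apply is_derive_Rmult; eassumption.
    + unfold minus, plus, opp, Re, Im; simpl; ring.
Qed.

Lemma cderiv_comp (f : R -> C) (g : R -> R) (x d : R) (l : C) :
  cderiv f (g x) l -> is_derive g x d ->
  cderiv (fun t => f (g t)) x (RtoC d * l).
Proof.
  intros [? ?] Hg; split; eapply is_derive_eq.
  - apply (is_derive_comp (fun t => Re (f t)) g); eassumption.
  - unfold scal, mult, Re; simpl; unfold mult; simpl; ring.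
  - apply (is_derive_comp (fun t => Im (f t)) g); eassumption.
  - unfold scal, mult, Im; simpl; unfold mult; simpl; ring.
Qed.

Lemma cderiv_CDerive (f : R -> C) (x : R) (l : C) : cderiv f x l -> CDerive f x = l.
Proof.
  intros [H1 H2]; apply C_ext; simpl; apply is_derive_unique; assumption.
Qed.

Lemma cderiv_ex_derive (f : R -> C) (x : R) (l : C) :
  cderiv f x l -> ex_derive (V := C_R_NormedModule) f x.
Proof.
  intros [H1 H2]. exists l.
  apply is_derive_ext with
    (fun t => plus (scal (Re (f t)) ((1, 0) : C_R_NormedModule))
                   (scal (Im (f t)) ((0, 1) : C_R_NormedModule))).
  { intros t. apply C_ext; unfold plus, scal, mult; simpl;
      unfold plus, scal, mult; simpl; unfold mult; simpl; ring. }
  replace l with (plus (scal (Re l) ((1, 0) : C_R_NormedModule))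
                   (scal (Im l) ((0, 1) : C_R_NormedModule))).
  2: { apply C_ext; unfold plus, scal, mult; simpl;
      unfold plus, scal, mult; simpl; unfold mult; simpl; ring. }
  apply (is_derive_plus (V := C_R_NormedModule));
    apply (is_derive_scal_l (V := C_R_NormedModule)); assumption.
Qed.

Lemma ex_derive_cderiv (f : R -> C) (x : R) :
  ex_derive (V := C_R_NormedModule) f x -> cderiv f x (CDerive f x).
Proof.
  intros [l Hl].
  assert (cderiv f x l) as Hc.
  { split.
    - eapply filterdiff_ext_lin.
      + apply (filterdiff_comp' f (fun z : C_R_NormedModule => fst z) x
                 (fun y => scal y l) (fun z => fst z)).
        * exact Hl.
        * apply filterdiff_linear, is_linear_fst.
      + reflexivity.
    - eapply filterdiff_ext_lin.
      + apply (filterdiff_comp' f (fun z : C_R_NormedModule => snd z) x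
                 (fun y => scal y l) (fun z => snd z)).
        * exact Hl.
        * apply filterdiff_linear, is_linear_snd.
      + reflexivity. }
  rewrite (cderiv_CDerive _ _ _ Hc). exact Hc.
Qed.


(** * Integrals of continuous complex-valued functions *)

Definition icont (f : R -> C) (a b : R) : Prop :=
  forall x, Rmin a b <= x <= Rmax a b -> ccont f x.

Lemma is_CInt (f : R -> C) (a b : R) : icont f a b ->
  is_RInt (V := C_R_NormedModule) f a b
    (RInt (fun t => Re (f t)) a b, RInt (fun t => Im (f t)) a b).
Proof.
  intros Hf.
  apply (is_RInt_fct_extend_pair (U := R_NormedModule) (V := R_NormedModule));
    apply (RInt_correct (V := R_CompleteNormedModule)),
      (ex_RInt_continuous (V := R_CompleteNormedModule));
    intros z Hz; apply (Hf z Hz).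
Qed.

Lemma CInt_components (f : R -> C) (a b : R) : icont f a b ->
  CInt f a b = (RInt (fun t => Re (f t)) a b, RInt (fun t => Im (f t)) a b).
Proof.
  intros Hf.
  exact (is_RInt_unique (V := C_R_CompleteNormedModule) f a b _ (is_CInt f a b Hf)).
Qed.

Lemma CInt_correct (f : R -> C) (a b : R) : icont f a b ->
  is_RInt (V := C_R_NormedModule) f a b (CInt f a b).
Proof. intros Hf. rewrite (CInt_components _ _ _ Hf). apply is_CInt, Hf. Qed.

Lemma CInt_unique (f : R -> C) (a b : R) (l : C) :
  is_RInt (V := C_R_NormedModule) f a b l -> CInt f a b = l.
Proof. exact (is_RInt_unique (V := C_R_CompleteNormedModule) f a b l). Qed.

Lemma CInt_ext (f g : R -> C) (a b : R) :
  (forall x, Rmin a b < x < Rmax a b -> f x = g x) -> CInt f a b = CInt g a b.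
Proof. exact (RInt_ext (V := C_R_CompleteNormedModule) f g a b). Qed.

Lemma CInt_point (f : R -> C) (a : R) : CInt f a a = 0.
Proof. exact (RInt_point (V := C_R_CompleteNormedModule) a f). Qed.

Lemma CInt_zero (f : R -> C) (a b : R) :
  (forall x, Rmin a b < x < Rmax a b -> f x = 0) -> CInt f a b = 0.
Proof.
  intros E. rewrite (CInt_ext f (fun _ => RtoC 0)) by exact E.
  rewrite CInt_components by (intros ? ?; apply ccont_const).
  apply C_ext; simpl; rewrite RInt_const; unfold scal; simpl;
    unfold mult; simpl; ring.
Qed.

Lemma CInt_plus (f g : R -> C) (a b : R) : icont f a b -> icont g a b ->
  CInt (fun t => f t + g t)%C a b = (CInt f a b + CInt g a b)%C.
Proof.
  intros Hf Hg. apply CInt_unique.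
  apply (is_RInt_plus (V := C_R_NormedModule)); apply CInt_correct; assumption.
Qed.

Lemma CInt_opp (f : R -> C) (a b : R) : icont f a b ->
  CInt (fun t => - f t)%C a b = (- CInt f a b)%C.
Proof.
  intros Hf. apply CInt_unique.
  apply (is_RInt_opp (V := C_R_NormedModule)), CInt_correct, Hf.
Qed.

Lemma CInt_Chasles (f : R -> C) (a b c : R) : icont f a b -> icont f b c ->
  (CInt f a b + CInt f b c)%C = CInt f a c.
Proof.
  intros Hf Hg. symmetry. apply CInt_unique.
  apply (is_RInt_Chasles (V := C_R_NormedModule) f a b c);
    apply CInt_correct; assumption.
Qed.

Lemma icont_mult (f g : R -> C) (a b : R) : icont f a b -> icont g a b ->
  icont (fun t => f t * g t)%C a b.
Proof. intros Hf Hg x Hx; apply ccont_mult; auto. Qed.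

Lemma CInt_mult_l (c : C) (f : R -> C) (a b : R) : icont f a b ->
  CInt (fun t => c * f t)%C a b = (c * CInt f a b)%C.
Proof.
  intros Hf.
  rewrite (CInt_components f a b Hf), CInt_components
    by (apply icont_mult; [intros ? ?; apply ccont_const | exact Hf]).
  assert (forall x, Rmin a b <= x <= Rmax a b -> continuous (fun t => Re (f t)) x) as H1
    by (intros; apply Hf; assumption).
  assert (forall x, Rmin a b <= x <= Rmax a b -> continuous (fun t => Im (f t)) x) as H2
    by (intros; apply Hf; assumption).
  apply (ex_RInt_continuous (V := R_CompleteNormedModule)) in H1.
  apply (ex_RInt_continuous (V := R_CompleteNormedModule)) in H2.
  apply (RInt_correct (V := R_CompleteNormedModule)) in H1.
  apply (RInt_correct (V := R_CompleteNormedModule)) in H2.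
  apply C_ext; simpl; apply (is_RInt_unique (V := R_CompleteNormedModule)).
  - apply (is_RInt_minus (V := R_NormedModule)
      (fun t => Re c * Re (f t)) (fun t => Im c * Im (f t)));
      apply (is_RInt_scal (V := R_NormedModule)); assumption.
  - apply (is_RInt_plus (V := R_NormedModule)
      (fun t => Re c * Im (f t)) (fun t => Im c * Re (f t)));
      apply (is_RInt_scal (V := R_NormedModule)); assumption.
Qed.

Lemma CInt_derive (F f : R -> C) (a b : R) :
  (forall x, Rmin a b <= x <= Rmax a b -> cderiv F x (f x)) -> icont f a b ->
  CInt f a b = (F b - F a)%C.
Proof.
  intros HF Hf. rewrite (CInt_components _ _ _ Hf).
  apply C_ext; simpl; apply (is_RInt_unique (V := R_CompleteNormedModule)).
  - apply (is_RInt_derive (V := R_CompleteNormedModule) (fun t => Re (F t)));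
      intros; [apply HF | apply Hf]; assumption.
  - apply (is_RInt_derive (V := R_CompleteNormedModule) (fun t => Im (F t)));
      intros; [apply HF | apply Hf]; assumption.
Qed.

Lemma CInt_opp_arg (f : R -> C) (a b : R) : icont f (- b) (- a) ->
  CInt (fun t => f (- t)) a b = CInt f (- b) (- a).
Proof.
  intros Hf.
  apply CInt_unique.
  pose proof (is_RInt_opp (V := C_R_NormedModule) _ _ _ _ (is_RInt_comp_opp (V := C_R_NormedModule) f a b _
    (is_RInt_swap (V := C_R_NormedModule) _ _ _ _ (CInt_correct _ _ _ Hf)))) as H.
  rewrite (opp_opp (G := C_R_NormedModule)) in H.
  revert H. apply is_RInt_ext. intros x _. apply (opp_opp (G := C_R_NormedModule)).
Qed.

Lemma CInt_norm_le (f : R -> C) (g : R -> R) (a b : R) : a <= b ->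
  icont f a b -> (forall x, a <= x <= b -> continuous g x) ->
  (forall x, a <= x <= b -> Cmod (f x) <= g x) ->
  Cmod (CInt f a b) <= RInt g a b.
Proof.
  intros Hab Hf Hg Hle.
  assert (forall z : C, norm (z : C_R_NormedModule) = Cmod z) as E.
  { intros z. unfold norm; simpl. unfold prod_norm, Cmod, norm; simpl.
    unfold abs; simpl. f_equal. rewrite !Rmult_1_r.
    rewrite <- !Rabs_mult. rewrite !Rabs_pos_eq; [reflexivity| |]; apply Rle_0_sqr. }
  rewrite <- E.
  apply (norm_RInt_le (V := C_R_NormedModule) f g a b).
  - exact Hab.
  - intros x Hx. rewrite E. auto.
  - apply CInt_correct, Hf.
  - apply (RInt_correct (V := R_CompleteNormedModule)),
      (ex_RInt_continuous (V := R_CompleteNormedModule)).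
    intros z Hz. apply Hg. rewrite Rmin_left, Rmax_right in Hz; assumption.
Qed.

(** * Functions of two real variables *)

Lemma continuity_2d_pt_comp (f p q : R -> R -> R) (x y : R) :
  continuity_2d_pt f (p x y) (q x y) ->
  continuity_2d_pt p x y -> continuity_2d_pt q x y ->
  continuity_2d_pt (fun u v => f (p u v) (q u v)) x y.
Proof.
  intros Hf Hp Hq eps.
  destruct (Hf eps) as [d Hd]. destruct (Hp d) as [d1 H1]. destruct (Hq d) as [d2 H2].
  exists (mkposreal (Rmin d1 d2) (Rmin_stable_in_posreal d1 d2)). simpl.
  intros u v Hu Hv.
  apply Hd; [apply H1 | apply H2]; eapply Rlt_le_trans; eauto using Rmin_l, Rmin_r.
Qed.

Lemma continuity_2d_pt_path (f : R -> R -> R) (p q : R -> R) (s : R) :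
  continuity_2d_pt f (p s) (q s) -> continuous p s -> continuous q s ->
  continuous (fun t => f (p t) (q t)) s.
Proof.
  intros Hf Hp Hq. apply (continuous_comp_2 p q f s Hp Hq).
  apply (proj1 (continuity_2d_pt_filterlim f (p s) (q s))), Hf.
Qed.

Lemma continuity_2d_pt_fst_only (f : R -> R) (x y : R) :
  continuous f x -> continuity_2d_pt (fun u _ => f u) x y.
Proof.
  intros Hf. apply (continuity_1d_2d_pt_comp f (fun u _ => u)).
  - apply continuity_pt_filterlim, Hf.
  - apply continuity_2d_pt_id1.
Qed.

Lemma ccont2_comp (f : R -> R -> C) (p q : R -> R -> R) (x y : R) :
  ccont2 f (p x y) (q x y) ->
  continuity_2d_pt p x y -> continuity_2d_pt q x y ->
  ccont2 (fun u v => f (p u v) (q u v)) x y.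
Proof.
  intros [H1 H2] Hp Hq; split.
  - apply (continuity_2d_pt_comp (fun u v => Re (f u v))); assumption.
  - apply (continuity_2d_pt_comp (fun u v => Im (f u v))); assumption.
Qed.

Lemma ccont2_path (f : R -> R -> C) (p q : R -> R) (s : R) :
  ccont2 f (p s) (q s) -> continuous p s -> continuous q s ->
  ccont (fun t => f (p t) (q t)) s.
Proof.
  intros [H1 H2] Hp Hq; split.
  - apply (continuity_2d_pt_path (fun u v => Re (f u v))); assumption.
  - apply (continuity_2d_pt_path (fun u v => Im (f u v))); assumption.
Qed.

Lemma ccont2_fst_only (b : R -> C) (x y : R) :
  ccont b x -> ccont2 (fun u _ => b u) x y.
Proof.
  intros [H1 H2]; split.
  - apply (continuity_2d_pt_fst_only (fun t => Re (b t))); assumption.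
  - apply (continuity_2d_pt_fst_only (fun t => Im (b t))); assumption.
Qed.

Lemma ccont2_ext_loc (f g : R -> R -> C) (x y : R) :
  locally_2d (fun u v => f u v = g u v) x y -> ccont2 f x y -> ccont2 g x y.
Proof.
  intros [d Hd] [H1 H2]; split.
  - apply continuity_2d_pt_ext_loc with (2 := H1).
    exists d; intros u v Hu Hv; rewrite Hd; auto.
  - apply continuity_2d_pt_ext_loc with (2 := H2).
    exists d; intros u v Hu Hv; rewrite Hd; auto.
Qed.

Lemma ccont2_plus (f g : R -> R -> C) (x y : R) :
  ccont2 f x y -> ccont2 g x y -> ccont2 (fun u v => f u v + g u v)%C x y.
Proof.
  intros [? ?] [? ?]; split; simpl;
    apply (continuity_2d_pt_plus (fun u v => _ (f u v)) (fun u v => _ (g u v)));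
    assumption.
Qed.

Lemma ccont2_opp (f : R -> R -> C) (x y : R) :
  ccont2 f x y -> ccont2 (fun u v => - f u v)%C x y.
Proof.
  intros [? ?]; split; simpl; apply (continuity_2d_pt_opp (fun u v => _ (f u v)));
    assumption.
Qed.

Lemma ccont2_mult (f g : R -> R -> C) (x y : R) :
  ccont2 f x y -> ccont2 g x y -> ccont2 (fun u v => f u v * g u v)%C x y.
Proof.
  intros [? ?] [? ?]; split; simpl.
  - apply (continuity_2d_pt_minus (fun u v => Re (f u v) * Re (g u v))
                             (fun u v => Im (f u v) * Im (g u v)));
    apply continuity_2d_pt_mult; assumption.
  - apply (continuity_2d_pt_plus (fun u v => Re (f u v) * Im (g u v))
                             (fun u v => Im (f u v) * Re (g u v)));
    apply continuity_2d_pt_mult; assumption.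
Qed.

(** A modulus of continuity [d] for the oscillation 1 bounds the variation along
    a segment from the origin by the number of steps shorter than [d] that it
    takes. *)
Lemma continuity_2d_pt_bounded (f : R -> R -> R) (r : R) : 0 < r ->
  (forall x y, Rabs x <= r -> Rabs y <= r -> continuity_2d_pt f x y) ->
  exists B, forall x y, Rabs x <= r -> Rabs y <= r -> Rabs (f x y) <= B.
Proof.
  intros Hr Hf.
  destruct (uniform_continuity_2d f (- r) r (- r) r) with (eps := mkposreal 1 Rlt_0_1)
    as [d Hd].
  { intros x y Hx Hy. apply Hf; apply Rabs_le; assumption. }
  destruct (nfloor_ex (r / d)) as [n [_ Hn]].
  { apply Rlt_le, Rdiv_lt_0_compat; [assumption | apply cond_pos]. }
  set (N := S n). assert (0 < INR N) as HN by (apply lt_0_INR; unfold N; lia).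
  assert (r / INR N < d) as Hstep.
  { apply (Rmult_lt_reg_r (INR N)); [assumption|].
    replace (r / INR N * INR N) with r by (field; lra).
    apply (Rmult_lt_reg_r (/ d)); [apply Rinv_0_lt_compat, cond_pos|].
    pose proof (cond_pos d).
    replace (d * INR N * / d) with (INR N) by (field; lra).
    unfold N; rewrite S_INR; unfold Rdiv in Hn; lra. }
  exists (Rabs (f 0 0) + INR N). intros x y Hx Hy.
  assert (forall i, (i <= N)%nat ->
    Rabs (f (INR i / INR N * x) (INR i / INR N * y)) <= Rabs (f 0 0) + INR i) as Hwalk.
  { assert (forall i z, (i <= N)%nat -> Rabs z <= r -> - r <= INR i / INR N * z <= r) as Hin.
    { intros i z Hi Hz. apply Rabs_le_between. rewrite Rabs_mult.
      assert (0 <= INR i / INR N <= 1) as [H0 H1].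
      { split.
        - apply Rdiv_le_0_compat; [apply pos_INR | assumption].
        - apply Rmult_le_reg_r with (INR N); [assumption|].
          replace (INR i / INR N * INR N) with (INR i) by (field; lra).
          rewrite Rmult_1_l. apply le_INR, Hi. }
      rewrite (Rabs_pos_eq _ H0). pose proof (Rabs_pos z). nra. }
    assert (forall i z, Rabs z <= r ->
      Rabs (INR (S i) / INR N * z - INR i / INR N * z) < d) as Hsmall.
    { intros i z Hz. rewrite S_INR.
      replace ((INR i + 1) / INR N * z - INR i / INR N * z) with (z / INR N) by (field; lra).
      apply Rle_lt_trans with (2 := Hstep). unfold Rdiv. rewrite Rabs_mult.
      assert (0 < / INR N) by (apply Rinv_0_lt_compat; assumption).
      rewrite (Rabs_pos_eq (/ INR N)) by lra. apply Rmult_le_compat_r; lra. }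
    induction i as [|i IH]; intros Hi.
    - change (INR 0) with 0. replace (0 / INR N) with 0 by (unfold Rdiv; ring).
      rewrite !Rmult_0_l. lra.
    - specialize (IH ltac:(lia)).
      specialize (Hd (INR i / INR N * x) (INR i / INR N * y)
                     (INR (S i) / INR N * x) (INR (S i) / INR N * y)
                     (Hin i x ltac:(lia) Hx) (Hin i y ltac:(lia) Hy)
                     (Hin (S i) x Hi Hx) (Hin (S i) y Hi Hy)
                     (Hsmall i x Hx) (Hsmall i y Hy)).
      simpl pos in Hd. rewrite (S_INR i) at 3.
      pose proof (Rabs_triang_inv (f (INR (S i) / INR N * x) (INR (S i) / INR N * y))
                 (f (INR i / INR N * x) (INR i / INR N * y))). lra. }
  specialize (Hwalk N (le_n N)).
  replace (INR N / INR N) with 1 in Hwalk by (field; lra).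
  rewrite !Rmult_1_l in Hwalk. exact Hwalk.
Qed.

Lemma Cmod_le_components (z : C) : Cmod z <= Rabs (Re z) + Rabs (Im z).
Proof.
  unfold Cmod. pose proof (Rabs_pos (fst z)). pose proof (Rabs_pos (snd z)).
  unfold Re, Im. apply Rsqr_incr_0_var; [|lra].
  rewrite Rsqr_sqrt by nra. unfold Rsqr.
  pose proof (Rsqr_abs (fst z)). pose proof (Rsqr_abs (snd z)). unfold Rsqr in *. nra.
Qed.

Lemma ccont2_bounded (f : R -> R -> C) (r : R) : 0 < r ->
  (forall x y, Rabs x <= r -> Rabs y <= r -> ccont2 f x y) ->
  exists B, 0 <= B /\ forall x y, Rabs x <= r -> Rabs y <= r -> Cmod (f x y) <= B.
Proof.
  intros Hr Hf.
  destruct (continuity_2d_pt_bounded (fun u v => Re (f u v)) r Hr) as [B1 H1].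
  { intros; apply Hf; assumption. }
  destruct (continuity_2d_pt_bounded (fun u v => Im (f u v)) r Hr) as [B2 H2].
  { intros; apply Hf; assumption. }
  assert (forall x y, Rabs x <= r -> Rabs y <= r -> Cmod (f x y) <= B1 + B2) as H.
  { intros x y Hx Hy. eapply Rle_trans; [apply Cmod_le_components|].
    specialize (H1 x y Hx Hy); specialize (H2 x y Hx Hy); simpl in *; lra. }
  exists (B1 + B2); split; [|exact H].
  eapply Rle_trans; [apply Cmod_ge_0|]. apply (H 0 0); rewrite Rabs_R0; lra.
Qed.

(** A continuous partial derivative in the first variable near the point and a
    partial derivative in the second one at the point give total
    differentiability. *)
Lemma is_derive_chain (f f1 : R -> R -> R) (f2 : R) (p q : R -> R) (s dp dq : R) :
  locally_2d (fun u v => is_derive (fun z => f z v) u (f1 u v)) (p s) (q s) ->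
  is_derive (fun z => f (p s) z) (q s) f2 ->
  continuity_2d_pt f1 (p s) (q s) ->
  is_derive p s dp -> is_derive q s dq ->
  is_derive (fun t => f (p t) (q t)) s (dp * f1 (p s) (q s) + dq * f2).
Proof.
  intros H1 H2 Hc Hp Hq.
  eapply filterdiff_ext_lin.
  - apply (filterdiff_comp'_2 p q f s (fun y => scal y dp) (fun y => scal y dq)
      (fun a b => plus (scal a (f1 (p s) (q s))) (scal b f2))).
    + exact Hp.
    + exact Hq.
    + apply (is_derive_filterdiff f (p s) (q s) f1 f2).
      * apply (proj1 (locally_2d_locally _ _ _)) in H1. exact H1.
      * exact H2.
      * apply (proj1 (continuity_2d_pt_filterlim f1 (p s) (q s))), Hc.
  - intros y. unfold scal, plus; simpl. unfold mult; simpl. ring.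
Qed.

Lemma cderiv_chain (f f1 : R -> R -> C) (f2 : C) (p q : R -> R) (s dp dq : R) :
  locally_2d (fun u v => cderiv (fun z => f z v) u (f1 u v)) (p s) (q s) ->
  cderiv (fun z => f (p s) z) (q s) f2 ->
  ccont2 f1 (p s) (q s) ->
  is_derive p s dp -> is_derive q s dq ->
  cderiv (fun t => f (p t) (q t)) s (RtoC dp * f1 (p s) (q s) + RtoC dq * f2).
Proof.
  intros [d Hd] H2 Hc Hp Hq. split; simpl; eapply is_derive_eq.
  - apply (is_derive_chain (fun u v => Re (f u v)) (fun u v => Re (f1 u v)) (Re f2) p q);
      [exists d; intros; apply Hd; assumption | apply H2 | apply Hc | exact Hp | exact Hq].
  - simpl; unfold Re; ring.
  - apply (is_derive_chain (fun u v => Im (f u v)) (fun u v => Im (f1 u v)) (Im f2) p q);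
      [exists d; intros; apply Hd; assumption | apply H2 | apply Hc | exact Hp | exact Hq].
  - simpl; unfold Im; ring.
Qed.

(** * Parametric integrals on the square |u| + |v| < a *)

Definition dom (a u v : R) : Prop := Rabs u + Rabs v < a.

Lemma dom_swap (a u v : R) : dom a u v -> dom a v u.
Proof. unfold dom; lra. Qed.

Lemma Rabs_segment (v b : R) : Rmin 0 v <= b <= Rmax 0 v -> Rabs b <= Rabs v.
Proof. unfold Rmin, Rmax, Rabs. repeat destruct Rle_dec; repeat destruct Rcase_abs; lra. Qed.

Lemma dom_segment (a u v b : R) : dom a u v -> Rmin 0 v <= b <= Rmax 0 v -> dom a u b.
Proof. unfold dom. intros H Hb. apply Rabs_segment in Hb. lra. Qed.

(** The neighbourhood contains the whole segments from the axis v = 0, over which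
    the parametric integrals run. *)
Lemma dom_open (a u v : R) : dom a u v ->
  exists eta : posreal, forall u' v', Rabs (u' - u) <= eta -> Rabs v' <= Rabs v + eta ->
    dom a u' v'.
Proof.
  unfold dom. intros H.
  assert (0 < (a - Rabs u - Rabs v) / 3) as He by lra.
  exists (mkposreal _ He). simpl. intros u' v' Hu Hv.
  pose proof (Rabs_triang_inv u' u). lra.
Qed.

Lemma dom_locally (a u v : R) : dom a u v -> locally_2d (dom a) u v.
Proof.
  intros H. destruct (dom_open a u v H) as [eta He]. exists eta.
  intros u' v' Hu Hv. apply He; [lra|].
  pose proof (Rabs_triang_inv v' v). lra.
Qed.

Lemma locally_Rabs (x : R) (P : R -> Prop) (eps : posreal) :
  (forall y, Rabs (y - x) < eps -> P y) -> locally x P.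
Proof. intros H. exists eps. intros y Hy. apply H, Hy. Qed.

Section RealParametric.

Context (a : R) (g : R -> R -> R)
  (Hg : forall u v, dom a u v -> continuity_2d_pt g u v).

Lemma slice_continuous (u v : R) : dom a u v -> continuous (g u) v.
Proof.
  intros H. apply (continuity_2d_pt_path g (fun _ => u) (fun t => t)).
  - apply Hg, H.
  - apply continuous_const.
  - apply continuous_id.
Qed.

Lemma slice_is_RInt (u v : R) : dom a u v -> is_RInt (g u) 0 v (RInt (g u) 0 v).
Proof.
  intros H. apply (RInt_correct (V := R_CompleteNormedModule)),
    (ex_RInt_continuous (V := R_CompleteNormedModule)).
  intros z Hz. eapply slice_continuous, dom_segment; eassumption.
Qed.

Lemma slice_RInt_derive (u v : R) : dom a u v ->
  is_derive (fun w => RInt (g u) 0 w) v (g u v).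
Proof.
  intros H. apply (is_derive_RInt (V := R_NormedModule) (g u) _ 0 v).
  - destruct (dom_locally a u v H) as [d Hd]. exists d. intros w Hw.
    apply slice_is_RInt, Hd; [rewrite Rminus_diag, Rabs_R0; apply cond_pos | exact Hw].
  - apply slice_continuous, H.
Qed.

(** In the first variable the integrand converges uniformly on a compact segment;
    in the second, the integral is differentiable. *)
Lemma slice_RInt_continuity (u v : R) : dom a u v ->
  continuity_2d_pt (fun u v => RInt (g u) 0 v) u v.
Proof.
  intros H eps. destruct (dom_open a u v H) as [eta He].
  set (L := Rabs v + eta).
  assert (0 < L) as HL by (unfold L; pose proof (Rabs_pos v); pose proof (cond_pos eta); lra).
  assert (0 < eps / (2 * L)) as He2.
  { apply Rdiv_lt_0_compat; [apply cond_pos | lra]. }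
  destruct (uniform_continuity_2d_1d' g (- L) L u) with (eps := mkposreal _ He2) as [d1 Hd1].
  { intros b Hb. apply Hg, He.
    - rewrite Rminus_diag, Rabs_R0. apply Rlt_le, cond_pos.
    - apply Rabs_le; exact Hb. }
  assert (continuous (fun w => RInt (g u) 0 w) v) as Hc.
  { apply (ex_derive_continuous (V := R_NormedModule)). eexists. apply slice_RInt_derive, H. }
  assert (0 < eps / 2) as He3 by (pose proof (cond_pos eps); lra).
  destruct (proj1 (filterlim_locally _ _) Hc (mkposreal _ He3)) as [d2 Hd2].
  set (d := Rmin eta (Rmin d1 d2)).
  assert (0 < d) as Hd by (unfold d; repeat apply Rmin_pos; apply cond_pos).
  exists (mkposreal d Hd). simpl. intros u' v' Hu Hv.
  assert (d <= eta /\ d <= d1 /\ d <= d2) as [E1 [E2 E3]].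
  { unfold d. pose proof (Rmin_l eta (Rmin d1 d2)). pose proof (Rmin_r eta (Rmin d1 d2)).
    pose proof (Rmin_l d1 d2). pose proof (Rmin_r d1 d2). lra. }
  assert (Rabs v' <= L) as Hv'.
  { pose proof (Rabs_triang_inv v' v). unfold L. lra. }
  assert (is_RInt (g u') 0 v' (RInt (g u') 0 v')) as J1.
  { apply slice_is_RInt, He; [lra | exact Hv']. }
  assert (is_RInt (g u) 0 v' (RInt (g u) 0 v')) as J2.
  { apply slice_is_RInt, He; [|exact Hv'].
    rewrite Rminus_diag, Rabs_R0. apply Rlt_le, cond_pos. }
  assert (Rabs (RInt (g u') 0 v' - RInt (g u) 0 v') <= Rabs (v' - 0) * (eps / (2 * L))) as B1.
  { apply (norm_RInt_le_const_abs (V := R_NormedModule) (fun b => g u' b - g u b) 0 v').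
    - intros b Hb. apply Rlt_le. apply Rabs_segment in Hb.
      assert (- L <= b <= L) by (apply Rabs_le_between; lra).
      apply (Hd1 b u b u'); try assumption.
      + pose proof (cond_pos d1); lra.
      + apply Rabs_le_between'; lra.
      + rewrite Rminus_diag, Rabs_R0. apply cond_pos.
    - apply (is_RInt_minus (V := R_NormedModule)); assumption. }
  assert (Rabs (RInt (g u) 0 v' - RInt (g u) 0 v) < eps / 2) as B2.
  { apply Hd2. apply Rlt_le_trans with d; assumption. }
  assert (Rabs (v' - 0) * (eps / (2 * L)) <= eps / 2) as B3.
  { rewrite Rminus_0_r. replace (eps / 2) with (L * (eps / (2 * L))) by (field; lra).
    apply Rmult_le_compat_r; lra. }
  replace (RInt (g u') 0 v' - RInt (g u) 0 v) with
    ((RInt (g u') 0 v' - RInt (g u) 0 v') + (RInt (g u) 0 v' - RInt (g u) 0 v)) by ring.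
  eapply Rle_lt_trans; [apply Rabs_triang|]. lra.
Qed.

Lemma slice_RInt_derive_param (g1 : R -> R -> R) (u v : R) :
  (forall u v, dom a u v -> is_derive (fun z => g z v) u (g1 u v)) ->
  (forall u v, dom a u v -> continuity_2d_pt g1 u v) ->
  dom a u v ->
  is_derive (fun z => RInt (g z) 0 v) u (RInt (g1 u) 0 v).
Proof.
  intros Hd Hg1 H. destruct (dom_open a u v H) as [eta He].
  eapply is_derive_eq.
  - apply (is_derive_RInt_param g 0 v u).
    + apply (locally_Rabs _ _ eta). intros z Hz t Ht. exists (g1 z t).
      apply Hd, He; [lra|]. apply Rabs_segment in Ht. pose proof (cond_pos eta); lra.
    + intros t Ht. assert (dom a u t) as Hut by (eapply dom_segment; eassumption).
      apply continuity_2d_pt_ext_loc with (2 := Hg1 u t Hut).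
      destruct (dom_locally a u t Hut) as [d Hdl]. exists d. intros z w Hz Hw.
      symmetry. apply is_derive_unique, Hd, Hdl; assumption.
    + apply (locally_Rabs _ _ eta). intros z Hz. eexists. apply slice_is_RInt, He; [lra|].
      pose proof (cond_pos eta); lra.
  - apply RInt_ext. intros t Ht. apply is_derive_unique, Hd.
    apply dom_segment with v; [exact H | lra].
Qed.

End RealParametric.

Definition int_snd (g : R -> R -> C) (u v : R) : C := CInt (g u) 0 v.
Definition int_fst (g : R -> R -> C) (u v : R) : C := CInt (fun z => g z v) 0 u.

Section ComplexParametric.

Context (a : R) (g : R -> R -> C) (Hg : forall u v, dom a u v -> ccont2 g u v).

Lemma dom_icont (u v : R) : dom a u v -> icont (g u) 0 v.
Proof.
  intros H x Hx. apply (ccont2_path g (fun _ => u) (fun t => t)).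
  - eapply Hg, dom_segment; eassumption.
  - apply continuous_const.
  - apply continuous_id.
Qed.

Lemma int_snd_ccont2 (u v : R) : dom a u v -> ccont2 (int_snd g) u v.
Proof.
  intros H. pose proof (dom_locally a u v H) as [d Hd].
  apply ccont2_ext_loc with (f := fun u v => (RInt (fun t => Re (g u t)) 0 v,
    RInt (fun t => Im (g u t)) 0 v)).
  - exists d. intros u' v' Hu Hv. symmetry. apply CInt_components, dom_icont, Hd; assumption.
  - split; simpl.
    + apply (slice_RInt_continuity a (fun u v => Re (g u v))); [apply Hg | exact H].
    + apply (slice_RInt_continuity a (fun u v => Im (g u v))); [apply Hg | exact H].
Qed.

Lemma int_snd_cderiv_2 (u v : R) : dom a u v -> cderiv (fun w => int_snd g u w) v (g u v).
Proof.
  intros H. pose proof (dom_locally a u v H) as [d Hd].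
  apply cderiv_ext_loc with (fun w => (RInt (fun t => Re (g u t)) 0 w,
    RInt (fun t => Im (g u t)) 0 w)).
  - apply (locally_Rabs _ _ d). intros w Hw. symmetry.
    apply CInt_components, dom_icont, Hd; [|exact Hw].
    rewrite Rminus_diag, Rabs_R0; apply cond_pos.
  - split; simpl.
    + apply (slice_RInt_derive a (fun u v => Re (g u v))); [apply Hg | exact H].
    + apply (slice_RInt_derive a (fun u v => Im (g u v))); [apply Hg | exact H].
Qed.

Lemma int_snd_cderiv_1 (g1 : R -> R -> C) (u v : R) :
  (forall u v, dom a u v -> cderiv (fun z => g z v) u (g1 u v)) ->
  (forall u v, dom a u v -> ccont2 g1 u v) ->
  dom a u v -> cderiv (fun z => int_snd g z v) u (int_snd g1 u v).
Proof.
  intros Hd Hg1 H. pose proof (dom_locally a u v H) as [d Hdl].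
  apply cderiv_ext_loc with (fun z => (RInt (fun t => Re (g z t)) 0 v,
    RInt (fun t => Im (g z t)) 0 v)).
  - apply (locally_Rabs _ _ d). intros z Hz. symmetry.
    apply CInt_components, dom_icont, Hdl; [exact Hz|].
    rewrite Rminus_diag, Rabs_R0; apply cond_pos.
  - unfold int_snd. rewrite CInt_components.
    + split; simpl.
      * apply (slice_RInt_derive_param a (fun u v => Re (g u v)) (fun u v Huv => proj1 (Hg u v Huv))
          (fun u v => Re (g1 u v)));
          [intros; apply Hd | intros; apply Hg1 |]; assumption.
      * apply (slice_RInt_derive_param a (fun u v => Im (g u v)) (fun u v Huv => proj2 (Hg u v Huv))
          (fun u v => Im (g1 u v)));
          [intros; apply Hd | intros; apply Hg1 |]; assumption.
    + intros x Hx. apply (ccont2_path g1 (fun _ => u) (fun t => t)).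
      * eapply Hg1, dom_segment; eassumption.
      * apply continuous_const.
      * apply continuous_id.
Qed.

End ComplexParametric.

Lemma ccont2_swap (g : R -> R -> C) (u v : R) :
  ccont2 g v u -> ccont2 (fun u v => g v u) u v.
Proof.
  intros H. apply (ccont2_comp g (fun _ y => y) (fun x _ => x)); [exact H| |].
  - apply continuity_2d_pt_id2.
  - apply continuity_2d_pt_id1.
Qed.

Lemma int_fst_ccont2 (a : R) (g : R -> R -> C) (u v : R) :
  (forall u v, dom a u v -> ccont2 g u v) -> dom a u v -> ccont2 (int_fst g) u v.
Proof.
  intros Hg H. apply (ccont2_swap (int_snd (fun u v => g v u))).
  apply (int_snd_ccont2 a).
  - intros. apply ccont2_swap, Hg, dom_swap; assumption.
  - apply dom_swap, H.
Qed.

Lemma int_fst_cderiv_1 (a : R) (g : R -> R -> C) (u v : R) :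
  (forall u v, dom a u v -> ccont2 g u v) -> dom a u v ->
  cderiv (fun z => int_fst g z v) u (g u v).
Proof.
  intros Hg H. apply (int_snd_cderiv_2 a (fun u v => g v u)).
  - intros. apply ccont2_swap, Hg, dom_swap; assumption.
  - apply dom_swap, H.
Qed.

Lemma int_fst_cderiv_2 (a : R) (g g2 : R -> R -> C) (u v : R) :
  (forall u v, dom a u v -> ccont2 g u v) ->
  (forall u v, dom a u v -> cderiv (fun z => g u z) v (g2 u v)) ->
  (forall u v, dom a u v -> ccont2 g2 u v) ->
  dom a u v -> cderiv (fun w => int_fst g u w) v (int_fst g2 u v).
Proof.
  intros Hg Hd Hg2 H.
  apply (int_snd_cderiv_1 a (fun u v => g v u)) with (g1 := fun u v => g2 v u).
  - intros. apply ccont2_swap, Hg, dom_swap; assumption.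
  - intros. apply Hd, dom_swap; assumption.
  - intros. apply ccont2_swap, Hg2, dom_swap; assumption.
  - apply dom_swap, H.
Qed.

(** * Smoothness of the Goursat solution *)

Definition cont_dom (a : R) (h : R -> R -> C) : Prop :=
  forall u v, dom a u v -> ccont2 h u v.

Definition partials (a : R) (h h1 h2 : R -> R -> C) : Prop :=
  forall u v, dom a u v ->
    cderiv (fun z => h z v) u (h1 u v) /\ cderiv (fun w => h u w) v (h2 u v).

(** Coinductive smoothness: each derivative is a function, arbitrary outside the
    domain, that is smooth again.  To show that every member of a family is smooth
    it is enough that the family is closed under derivatives, without induction on
    the order. *)
CoInductive smooth1 (a : R) (b : R -> C) : Prop :=
| Smooth1 (b' : R -> C) :
    (forall x, interval a x -> cderiv b x (b' x)) -> smooth1 a b' -> smooth1 a b.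

CoInductive smooth2 (a : R) (h : R -> R -> C) : Prop :=
| Smooth2 (h1 h2 : R -> R -> C) :
    cont_dom a h -> partials a h h1 h2 -> smooth2 a h1 -> smooth2 a h2 -> smooth2 a h.

Lemma smooth_on_smooth1 (a : R) (b : R -> C) : smooth_on (interval a) b -> smooth1 a b.
Proof.
  revert b. cofix IH. intros b Hb. apply (Smooth1 a b (CDerive b)).
  - intros x Hx. apply ex_derive_cderiv, (Hb 0%nat x Hx).
  - apply IH. intros n x Hx. unfold CDerive_n. rewrite <- Nat.iter_succ_r.
    apply (Hb (S n) x Hx).
Qed.

Lemma smooth2_cont (a : R) (h : R -> R -> C) : smooth2 a h -> cont_dom a h.
Proof. intros [? ? Hc _ _ _]; exact Hc. Qed.

Lemma smooth2_lincomb (a : R) (c d : C) (h g : R -> R -> C) :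
  smooth2 a h -> smooth2 a g -> smooth2 a (fun u v => c * h u v + d * g u v)%C.
Proof.
  revert h g. cofix IH. intros h g [h1 h2 Hc Hp Hs1 Hs2] [g1 g2 Gc Gp Gs1 Gs2].
  apply (Smooth2 a _ (fun u v => c * h1 u v + d * g1 u v)%C
                     (fun u v => c * h2 u v + d * g2 u v)%C).
  - intros u v H. apply ccont2_plus; apply ccont2_mult; auto;
      apply (ccont2_fst_only (fun _ => _)), ccont_const.
  - intros u v H. destruct (Hp u v H) as [P1 P2]. destruct (Gp u v H) as [Q1 Q2].
    split; (eapply cderiv_eq; [apply cderiv_plus; apply cderiv_mult;
      [apply cderiv_const | eassumption | apply cderiv_const | eassumption] | cbv beta; ring]).
  - apply IH; assumption.
  - apply IH; assumption.
Qed.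

Lemma smooth2_antidiag (a : R) (h : R -> R -> C) :
  smooth2 a h -> smooth1 a (fun x => h 0 (- x)).
Proof.
  enough (forall c h, smooth2 a h -> smooth1 a (fun x => c * h 0%R (- x)%R)%C) as E.
  { intros Hh. specialize (E 1%C h Hh).
    replace (fun x => h 0 (- x)) with (fun x => 1 * h 0%R (- x)%R)%C; [exact E|].
    extensionality x; ring. }
  cofix IH. intros c g [h1 h2 Hc Hp Hs1 Hs2].
  apply (Smooth1 a _ (fun x => (- c) * h2 0%R (- x)%R)%C).
  - intros x Hx. assert (dom a 0 (- x)) as H.
    { unfold dom. rewrite Rabs_R0, Rabs_Ropp. unfold interval in Hx.
      pose proof (Rabs_def1 x a (proj2 Hx) (proj1 Hx)). lra. }
    eapply cderiv_eq.
    + apply cderiv_mult; [apply cderiv_const|].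
      apply (cderiv_comp (fun y => g 0 y) (fun x => - x) x (-1)).
      * apply Hp, H.
      * auto_derive; [exact I | ring].
    + apply C_ext; simpl; unfold Re, Im; ring.
  - apply IH; assumption.
Qed.

Lemma interval_Rabs (a x : R) : interval a x <-> Rabs x < a.
Proof.
  unfold interval. split.
  - intros [? ?]. apply Rabs_def1; assumption.
  - intros H. apply Rabs_def2 in H. lra.
Qed.

Lemma smooth2_diag (a : R) (h : R -> R -> C) : smooth2 a h -> smooth1 a (fun x => h x 0).
Proof.
  revert h. cofix IH. intros h [h1 h2 Hc Hp Hs1 Hs2].
  apply (Smooth1 a _ (fun x => h1 x 0)).
  - intros x Hx. apply Hp. unfold dom. rewrite Rabs_R0.
    apply interval_Rabs in Hx. lra.
  - apply IH, Hs1.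
Qed.

Lemma smooth1_ccont (a : R) (b : R -> C) (x : R) :
  smooth1 a b -> interval a x -> ccont b x.
Proof. intros [b' Hd _] Hx. eapply cderiv_ccont, Hd, Hx. Qed.

Section KernelSmooth.

Context (a : R) (q : R -> C) (H : R -> R -> C)
  (Hq : smooth1 a q) (HH : is_H a q H).

(** The terms that arise when the integral equation for [H] is differentiated
    repeatedly. *)
Inductive jet : (R -> R -> C) -> Prop :=
| jet_H : jet H
| jet_fst b : smooth1 a b -> jet (fun u _ => b u)
| jet_sum b : smooth1 a b -> jet (fun u v => b (u + v))
| jet_plus h g : jet h -> jet g -> jet (fun u v => h u v + g u v)%C
| jet_mult h g : jet h -> jet g -> jet (fun u v => h u v * g u v)%C
| jet_int_fst h : jet h -> jet (int_fst h)
| jet_int_snd h : jet h -> jet (int_snd h).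

(** The right-hand side of the wave equation d_u d_v H = q(u+v) H. *)
Definition source (u v : R) : C := (q (u + v) * H u v)%C.

Lemma dom_sum (u v : R) : dom a u v -> interval a (u + v).
Proof.
  intros Hd. apply interval_Rabs. unfold dom in Hd. pose proof (Rabs_triang u v). lra.
Qed.

Lemma dom_fst (u v : R) : dom a u v -> interval a u.
Proof.
  intros Hd. apply interval_Rabs. unfold dom in Hd. pose proof (Rabs_pos v). lra.
Qed.

Lemma H_cont : cont_dom a H.
Proof.
  intros u v Hd. pose proof (proj1 HH u v Hd) as Hc.
  split; apply continuity_2d_pt_filterlim.
  - apply (continuous_comp (fun p : R * R => H (fst p) (snd p))
      (fun z : C_R_NormedModule => fst z)); [exact Hc | apply continuous_fst].
  - apply (continuous_comp (fun p : R * R => H (fst p) (snd p))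
      (fun z : C_R_NormedModule => snd z)); [exact Hc | apply continuous_snd].
Qed.

Lemma jet_cont (h : R -> R -> C) : jet h -> cont_dom a h.
Proof.
  induction 1; intros u v Hd.
  - apply H_cont, Hd.
  - apply ccont2_fst_only. eapply smooth1_ccont; [eassumption | eapply dom_fst, Hd].
  - apply (ccont2_comp (fun x _ => b x) (fun u v => u + v) (fun _ _ => 0)).
    + apply ccont2_fst_only. eapply smooth1_ccont; [eassumption | apply dom_sum, Hd].
    + apply continuity_2d_pt_plus; [apply continuity_2d_pt_id1 | apply continuity_2d_pt_id2].
    + apply continuity_2d_pt_const.
  - apply ccont2_plus; auto.
  - apply ccont2_mult; auto.
  - apply (int_fst_ccont2 a); assumption.
  - apply (int_snd_ccont2 a); assumption.
Qed.

Lemma jet_source : jet source.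
Proof. apply jet_mult; [apply jet_sum, Hq | apply jet_H]. Qed.

Lemma source_cont : cont_dom a source.
Proof. apply jet_cont, jet_source. Qed.

Lemma H_eq (u v : R) : dom a u v ->
  H u v = (RtoC (1 / 2) * CInt q 0 u + int_fst (int_snd source) u v)%C.
Proof. exact (proj2 HH u v). Qed.

Lemma q_primitive (u : R) : interval a u -> cderiv (fun z => CInt q 0 z) u (q u).
Proof.
  intros Hu. apply (int_snd_cderiv_2 a (fun _ t => q t)) with (u := 0).
  - intros x y Hd. apply (ccont2_swap (fun u _ => q u)), ccont2_fst_only.
    eapply smooth1_ccont; [exact Hq|]. eapply dom_fst, dom_swap, Hd.
  - unfold dom. rewrite Rabs_R0. apply interval_Rabs in Hu. lra.
Qed.

(** In the integral equation one of the two integrations is undone by the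
    derivative; the primitive of [q] depends on the first variable only. *)
Lemma H_partials :
  partials a H (fun u v => RtoC (1 / 2) * q u + int_snd source u v)%C (int_fst source).
Proof.
  intros u v Hd. pose proof (dom_locally a u v Hd) as [d Hdl]. split.
  - apply cderiv_ext_loc with (fun z => RtoC (1 / 2) * CInt q 0 z + int_fst (int_snd source) z v)%C.
    + apply (locally_Rabs _ _ d). intros z Hz. symmetry. apply H_eq, Hdl; [exact Hz|].
      rewrite Rminus_diag, Rabs_R0; apply cond_pos.
    + eapply cderiv_eq.
      * apply cderiv_plus.
        -- apply cderiv_mult; [apply cderiv_const | eapply q_primitive, dom_fst, Hd].
        -- apply (int_fst_cderiv_1 a); [|exact Hd]. intros; apply (int_snd_ccont2 a);
             [apply source_cont | assumption].
      * cbv beta; ring.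
  - apply cderiv_ext_loc with (fun w => RtoC (1 / 2) * CInt q 0 u + int_fst (int_snd source) u w)%C.
    + apply (locally_Rabs _ _ d). intros w Hw. symmetry. apply H_eq, Hdl; [|exact Hw].
      rewrite Rminus_diag, Rabs_R0; apply cond_pos.
    + eapply cderiv_eq.
      * apply cderiv_plus; [apply cderiv_const|].
        apply (int_fst_cderiv_2 a (int_snd source) source).
        -- intros; apply (int_snd_ccont2 a); [apply source_cont | assumption].
        -- intros; apply (int_snd_cderiv_2 a); [apply source_cont | assumption].
        -- apply source_cont.
        -- exact Hd.
      * cbv beta; ring.
Qed.

Lemma smooth1_const (c : C) : smooth1 a (fun _ => c).
Proof.
  revert c. cofix IH. intros c. apply (Smooth1 a _ (fun _ => RtoC 0)).
  - intros; apply cderiv_const.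
  - apply IH.
Qed.

(** Differentiating an integral either undoes it or differentiates the integrand
    under it, so the family is stable; [H] itself is covered by [H_partials]. *)
Lemma jet_partials (h : R -> R -> C) : jet h ->
  exists h1 h2, jet h1 /\ jet h2 /\ partials a h h1 h2.
Proof.
  induction 1 as [ | b Hb | b Hb | h g Hh IHh Hg IHg | h g Hh IHh Hg IHg
                 | h Hh IHh | h Hh IHh].
  - exists (fun u v => RtoC (1 / 2) * q u + int_snd source u v)%C, (int_fst source).
    split; [|split; [apply jet_int_fst, jet_source | exact H_partials]].
    apply jet_plus; [|apply jet_int_snd, jet_source].
    apply (jet_mult (fun _ _ => RtoC (1 / 2))).
    + apply (jet_fst (fun _ => _)), smooth1_const.
    + apply jet_fst, Hq.
  - destruct Hb as [b' Hd Hb']. exists (fun u _ => b' u), (fun _ _ => RtoC 0).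
    split; [apply jet_fst, Hb'|].
    split; [apply (jet_fst (fun _ => _)), smooth1_const|].
    intros u v Huv. split; [apply Hd; eapply dom_fst, Huv | apply cderiv_const].
  - destruct Hb as [b' Hd Hb']. exists (fun u v => b' (u + v)), (fun u v => b' (u + v)).
    split; [apply jet_sum, Hb'|]. split; [apply jet_sum, Hb'|].
    intros u v Huv. apply dom_sum, Hd in Huv.
    split; (eapply cderiv_eq;
      [apply (cderiv_comp b _ _ 1); [exact Huv | auto_derive; [exact I | ring]] | cbv beta; ring]).
  - destruct IHh as [h1 [h2 [J1 [J2 P]]]], IHg as [g1 [g2 [K1 [K2 Q]]]].
    exists (fun u v => h1 u v + g1 u v)%C, (fun u v => h2 u v + g2 u v)%C.
    split; [apply jet_plus; assumption|]. split; [apply jet_plus; assumption|].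
    intros u v Huv. split; apply cderiv_plus; apply P || apply Q; exact Huv.
  - destruct IHh as [h1 [h2 [J1 [J2 P]]]], IHg as [g1 [g2 [K1 [K2 Q]]]].
    exists (fun u v => h1 u v * g u v + h u v * g1 u v)%C,
           (fun u v => h2 u v * g u v + h u v * g2 u v)%C.
    split; [apply jet_plus; apply jet_mult; assumption|].
    split; [apply jet_plus; apply jet_mult; assumption|].
    intros u v Huv. destruct (P u v Huv) as [P1 P2]. destruct (Q u v Huv) as [Q1 Q2].
    split.
    + apply (cderiv_mult (fun z => h z v) (fun z => g z v)); assumption.
    + apply (cderiv_mult (fun z => h u z) (fun z => g u z)); assumption.
  - destruct IHh as [h1 [h2 [J1 [J2 P]]]]. exists h, (int_fst h2).
    split; [assumption|]. split; [apply jet_int_fst; assumption|].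
    intros u v Huv. split.
    + apply (int_fst_cderiv_1 a); [apply jet_cont, Hh | exact Huv].
    + apply (int_fst_cderiv_2 a h h2); try apply jet_cont; try assumption.
      intros; apply P; assumption.
  - destruct IHh as [h1 [h2 [J1 [J2 P]]]]. exists (int_snd h1), h.
    split; [apply jet_int_snd; assumption|]. split; [assumption|].
    intros u v Huv. split.
    + apply (int_snd_cderiv_1 a h (jet_cont h Hh) h1); try apply jet_cont; try assumption.
      intros; apply P; assumption.
    + apply (int_snd_cderiv_2 a); [apply jet_cont, Hh | exact Huv].
Qed.

Lemma jet_smooth2 (h : R -> R -> C) : jet h -> smooth2 a h.
Proof.
  revert h. cofix IH. intros h Hh.
  destruct (jet_partials h Hh) as [h1 [h2 [J1 [J2 P]]]].
  apply (Smooth2 a h h1 h2); [apply jet_cont, Hh | exact P | apply IH, J1 | apply IH, J2].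
Qed.

End KernelSmooth.

(** * The Volterra operator *)

Definition volterra (a : R) (h : R -> R -> C) (f : R -> C) (x : R) : C :=
  (CInt (fun t => kernel h t x * f t) (Rabs x) a
   - CInt (fun t => kernel h t x * f t) (- a) (- Rabs x))%C.

Lemma Tsquare_volterra (a : R) (h : R -> R -> C) (f : R -> C) :
  Tsquare a (kernel h) f = fun x => (f x + volterra a h f x)%C.
Proof. extensionality x. unfold Tsquare, volterra. ring. Qed.

Definition cont_supported (r : R) (f : R -> C) : Prop :=
  (forall x, ccont f x) /\ supported_in r f.

(** Leibniz rule with a variable lower limit, for an integrand that is regular on
    the whole strip |x| < a. *)
Lemma RInt_lower_derive (a b : R) (g g1 : R -> R -> R) (x : R) : Rabs x < a ->
  (forall y t, Rabs y < a -> is_derive (fun z => g z t) y (g1 y t)) ->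
  (forall y t, Rabs y < a -> continuity_2d_pt g1 y t) ->
  (forall y t, Rabs y < a -> continuous (g y) t) ->
  is_derive (fun z => RInt (g z) z b) x (RInt (g1 x) x b - g x x).
Proof.
  intros Hx Hd Hg1 Hg.
  assert (forall y c d, Rabs y < a -> ex_RInt (g y) c d) as Hex.
  { intros y c d Hy. apply (ex_RInt_continuous (V := R_CompleteNormedModule)). auto. }
  assert (0 < a - Rabs x) as Hp by lra. set (eta := mkposreal _ Hp).
  assert (forall y, Rabs (y - x) < eta -> Rabs y < a) as Hin.
  { intros y Hy. simpl in Hy. pose proof (Rabs_triang_inv y x). lra. }
  assert (forall y t, Rabs y < a ->
    continuity_2d_pt (fun u v => Derive (fun z => g z v) u) y t) as Hc.
  { intros y t Hy. apply continuity_2d_pt_ext_loc with (2 := Hg1 y t Hy).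
    assert (0 < a - Rabs y) as Hq by lra. exists (mkposreal _ Hq). simpl.
    intros u v Hu _. symmetry. apply is_derive_unique, Hd.
    pose proof (Rabs_triang_inv u y). lra. }
  eapply is_derive_eq.
  - apply (is_derive_RInt_param_bound_comp_aux2 g (fun z => z) b x 1).
    + apply (locally_Rabs _ _ eta). intros y Hy. apply Hex, Hin, Hy.
    + exists (mkposreal 1 Rlt_0_1). apply (locally_Rabs _ _ eta). intros y Hy.
      apply Hex, Hin, Hy.
    + apply (is_derive_id (K := R_AbsRing)).
    + exists (mkposreal 1 Rlt_0_1). apply (locally_Rabs _ _ eta). intros y Hy t _.
      eexists. apply Hd, Hin, Hy.
    + intros t _. apply Hc, Hx.
    + exists eta. intros y t Hy _. apply Hc, Hin, Hy.
    + apply continuity_pt_filterlim, Hg, Hx.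
  - rewrite Rmult_1_r. unfold Rminus; f_equal. apply RInt_ext. intros t _.
    apply is_derive_unique, Hd, Hx.
Qed.

Lemma ccont2_slice (g : R -> R -> C) (y t : R) : ccont2 g y t -> ccont (g y) t.
Proof.
  intros H. apply (ccont2_path g (fun _ => y) (fun t => t));
    [exact H | apply continuous_const | apply continuous_id].
Qed.

Lemma CInt_lower_derive (a b : R) (g g1 : R -> R -> C) (x : R) : Rabs x < a ->
  (forall y t, Rabs y < a -> cderiv (fun z => g z t) y (g1 y t)) ->
  (forall y t, Rabs y < a -> ccont2 g1 y t) ->
  (forall y t, Rabs y < a -> ccont2 g y t) ->
  cderiv (fun z => CInt (g z) z b) x (CInt (g1 x) x b - g x x).
Proof.
  intros Hx Hd Hg1 Hg.
  assert (0 < a - Rabs x) as Hp by lra.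
  apply cderiv_ext_loc with (fun z => (RInt (fun t => Re (g z t)) z b,
    RInt (fun t => Im (g z t)) z b)).
  - apply (locally_Rabs _ _ (mkposreal _ Hp)). simpl. intros z Hz. symmetry.
    apply CInt_components. intros t _. apply ccont2_slice, Hg.
    pose proof (Rabs_triang_inv z x). lra.
  - rewrite CInt_components by (intros t _; apply ccont2_slice, Hg1, Hx).
    split; simpl.
    + apply (RInt_lower_derive a b (fun z t => Re (g z t)) (fun z t => Re (g1 z t)));
        [exact Hx | intros; apply Hd | intros; apply Hg1
        | intros; apply ccont2_slice, Hg]; assumption.
    + apply (RInt_lower_derive a b (fun z t => Im (g z t)) (fun z t => Im (g1 z t)));
        [exact Hx | intros; apply Hd | intros; apply Hg1
        | intros; apply ccont2_slice, Hg]; assumption.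
Qed.

Lemma kernel_dom (a t x : R) : Rabs t < a -> Rabs x < a -> dom a ((t + x) / 2) ((t - x) / 2).
Proof.
  unfold dom, Rabs. intros. repeat destruct Rcase_abs; lra.
Qed.

Lemma kernel_diag (h : R -> R -> C) (x : R) : kernel h x x = h x 0.
Proof. unfold kernel. f_equal; field. Qed.

Lemma kernel_antidiag (h : R -> R -> C) (x : R) : kernel h (- x) x = h 0 (- x).
Proof. unfold kernel. f_equal; field. Qed.

Lemma continuity_2d_pt_affine (c d x y : R) :
  continuity_2d_pt (fun u v => (c * u + d * v) / 2) x y.
Proof.
  unfold Rdiv. apply continuity_2d_pt_mult; [|apply continuity_2d_pt_const].
  apply continuity_2d_pt_plus; apply continuity_2d_pt_mult;
    try apply continuity_2d_pt_const.
  - apply continuity_2d_pt_id1.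
  - apply continuity_2d_pt_id2.
Qed.

Lemma kernel_ccont2 (a : R) (h : R -> R -> C) (x t : R) : cont_dom a h ->
  Rabs x < a -> Rabs t < a -> ccont2 (fun x t => kernel h t x) x t.
Proof.
  intros Hh Hx Ht. unfold kernel.
  apply (ccont2_comp h (fun x t => (t + x) / 2) (fun x t => (t - x) / 2)).
  - apply Hh, kernel_dom; assumption.
  - eapply continuity_2d_pt_ext; [|apply (continuity_2d_pt_affine 1 1)].
    intros u v; simpl; field.
  - eapply continuity_2d_pt_ext; [|apply (continuity_2d_pt_affine (-1) 1)].
    intros u v; simpl; field.
Qed.

(** From the partial derivatives [h1], [h2] of [h]: the function whose kernel is
    the derivative of the kernel of [h] in its second variable ([dminus]) or in
    its first one ([dplus]). *)
Definition dminus (h1 h2 : R -> R -> C) (u v : R) : C :=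
  (RtoC (1 / 2) * h1 u v + RtoC (- (1 / 2)) * h2 u v)%C.
Definition dplus (h1 h2 : R -> R -> C) (u v : R) : C :=
  (RtoC (1 / 2) * h1 u v + RtoC (1 / 2) * h2 u v)%C.

Lemma kernel_cderiv_2 (a : R) (h h1 h2 : R -> R -> C) (t x : R) :
  partials a h h1 h2 -> cont_dom a h1 -> Rabs t < a -> Rabs x < a ->
  cderiv (fun z => kernel h t z) x (kernel (dminus h1 h2) t x).
Proof.
  intros Hp H1 Ht Hx. pose proof (kernel_dom a t x Ht Hx) as Hd.
  unfold kernel, dminus.
  apply (cderiv_chain h h1 (h2 ((t + x) / 2) ((t - x) / 2))
    (fun z => (t + z) / 2) (fun z => (t - z) / 2)).
  - destruct (dom_locally _ _ _ Hd) as [d Hl]. exists d. intros; apply Hp, Hl; assumption.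
  - apply Hp, Hd.
  - apply H1, Hd.
  - auto_derive; [exact I | field].
  - auto_derive; [exact I | field].
Qed.

Lemma kernel_cderiv_1 (a : R) (h h1 h2 : R -> R -> C) (t x : R) :
  partials a h h1 h2 -> cont_dom a h1 -> Rabs t < a -> Rabs x < a ->
  cderiv (fun z => kernel h z x) t (kernel (dplus h1 h2) t x).
Proof.
  intros Hp H1 Ht Hx. pose proof (kernel_dom a t x Ht Hx) as Hd.
  unfold kernel, dplus.
  apply (cderiv_chain h h1 (h2 ((t + x) / 2) ((t - x) / 2))
    (fun z => (z + x) / 2) (fun z => (z - x) / 2)).
  - destruct (dom_locally _ _ _ Hd) as [d Hl]. exists d. intros; apply Hp, Hl; assumption.
  - apply Hp, Hd.
  - apply H1, Hd.
  - auto_derive; [exact I | field].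
  - auto_derive; [exact I | field].
Qed.

Lemma cont_dom_lincomb (a : R) (c d : C) (h g : R -> R -> C) :
  cont_dom a h -> cont_dom a g -> cont_dom a (fun u v => c * h u v + d * g u v)%C.
Proof.
  intros Hh Hg u v H. apply ccont2_plus; apply ccont2_mult; auto;
      apply (ccont2_fst_only (fun _ => _)), ccont_const.
Qed.

(** Identities and regularity outside the support are local; this reduces every
    statement at such a point to one about the zero function. *)
Lemma supported_near (r t : R) (f : R -> C) : supported_in r f -> r < Rabs t ->
  exists eta : posreal, forall s, Rabs (s - t) < eta -> f s = 0.
Proof.
  intros Hf Ht. assert (0 < Rabs t - r) as Hp by lra. exists (mkposreal _ Hp). simpl.
  intros s Hs. apply Hf. pose proof (Rabs_triang_inv t s) as Hi.
  rewrite (Rabs_minus_sym t s) in Hi. lra.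
Qed.

(** On [-r,r] the weight e^{-lam |x|} is at least e^{-lam r}, so weighted and
    unweighted sup norms are equivalent for functions supported there. *)
Lemma weight_of_sup (lam r : R) (f : R -> C) (M : R) : 0 < lam -> supported_in r f ->
  (forall x, Cmod (f x) <= M) ->
  forall x, Cmod (f x) <= M * exp (lam * r) * exp (- lam * Rabs x).
Proof.
  intros Hlam Hf HM y.
  assert (0 <= M) as HM0 by (eapply Rle_trans; [apply Cmod_ge_0 | apply (HM 0)]).
  rewrite Rmult_assoc, <- exp_plus.
  destruct (Rle_lt_dec (Rabs y) r) as [Hy | Hy].
  - eapply Rle_trans; [apply HM|]. pose proof (exp_ineq1_le (lam * r + - lam * Rabs y)).
    assert (0 <= lam * r + - lam * Rabs y) by nra. nra.
  - rewrite (Hf y Hy), Cmod_0. apply Rmult_le_pos; [exact HM0 | apply Rlt_le, exp_pos].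
Qed.

Lemma weight_le_1 (lam x : R) : 0 < lam -> exp (- lam * Rabs x) <= 1.
Proof.
  intros Hlam.
  rewrite <- exp_0. destruct (Req_dec (- lam * Rabs x) 0) as [-> | Hne]; [lra|].
  apply Rlt_le, exp_increasing. pose proof (Rabs_pos x). nra.
Qed.

Section Volterra.

Context (a r : R) (Hr : r < a).

(** The kernel is controlled for |t| < a only; beyond the support of [f] the
    product vanishes, so the integrand is continuous for all t. *)
Lemma integrand_ccont2 (h : R -> R -> C) (f : R -> C) (x t : R) :
  cont_dom a h -> cont_supported r f -> Rabs x < a -> ccont2 (fun x t => kernel h t x * f t)%C x t.
Proof.
  intros Hh [Hf Hs] Hx. destruct (Rle_lt_dec (Rabs t) r) as [Ht | Ht].
  - apply ccont2_mult.
    + apply (kernel_ccont2 a); [exact Hh | exact Hx | lra].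
    + apply (ccont2_swap (fun u _ => f u)), ccont2_fst_only, Hf.
  - destruct (supported_near r t f Hs Ht) as [eta He].
    apply ccont2_ext_loc with (fun _ _ => RtoC 0).
    + exists eta. intros u v _ Hv. rewrite He by exact Hv. ring.
    + apply (ccont2_fst_only (fun _ => _)), ccont_const.
Qed.

(** The two integrals over t > 0 and t < 0 joined in one over t > 0.  The
    integrand is odd in [t]. *)
Definition folded (h : R -> R -> C) (f : R -> C) (x t : R) : C :=
  (kernel h t x * f t - kernel h (- t) x * f (- t)%R)%C.

Lemma folded_ccont2 (h : R -> R -> C) (f : R -> C) (x t : R) :
  cont_dom a h -> cont_supported r f -> Rabs x < a -> ccont2 (folded h f) x t.
Proof.
  intros Hh Hf Hx. unfold folded.
  apply (ccont2_plus (fun x t => kernel h t x * f t)%C); [|apply ccont2_opp].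
  - apply integrand_ccont2; assumption.
  - apply (ccont2_comp (fun x t => kernel h t x * f t)%C (fun x _ => x) (fun _ t => - t)).
    + apply integrand_ccont2; assumption.
    + apply continuity_2d_pt_id1.
    + apply (continuity_2d_pt_opp (fun _ t => t)), continuity_2d_pt_id2.
Qed.

Lemma integrand_icont (h : R -> R -> C) (f : R -> C) (x c d : R) :
  cont_dom a h -> cont_supported r f -> Rabs x < a -> icont (fun t => kernel h t x * f t)%C c d.
Proof.
  intros Hh Hf Hx t _. apply (ccont2_slice (fun x t => kernel h t x * f t)%C).
  apply integrand_ccont2; assumption.
Qed.

Lemma folded_icont (h : R -> R -> C) (f : R -> C) (x c d : R) :
  cont_dom a h -> cont_supported r f -> Rabs x < a -> icont (folded h f x) c d.
Proof. intros Hh Hf Hx t _. apply ccont2_slice, folded_ccont2; assumption. Qed.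

Lemma volterra_folded_Rabs (h : R -> R -> C) (f : R -> C) (x : R) :
  cont_dom a h -> cont_supported r f -> Rabs x < a -> volterra a h f x = CInt (folded h f x) (Rabs x) a.
Proof.
  intros Hh Hf Hx. unfold volterra, folded.
  rewrite <- (CInt_opp_arg (fun t => kernel h t x * f t)%C) by (apply integrand_icont; assumption).
  unfold Cminus. rewrite <- CInt_opp.
  - rewrite <- CInt_plus; [reflexivity | apply integrand_icont; assumption |].
    intros t _. apply ccont_opp. 
    apply (ccont_comp (fun t => kernel h t x * f t)%C (fun t => - t)).
    + apply (continuous_opp (fun t : R => t)), continuous_id.
    + apply (integrand_icont h f x (- t) (- t)); try assumption.
      rewrite Rmin_left, Rmax_left; lra.
  - intros t _. 
    apply (ccont_comp (fun t => kernel h t x * f t)%C (fun t => - t)).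
    + apply (continuous_opp (fun t : R => t)), continuous_id.
    + apply (integrand_icont h f x (- t) (- t)); try assumption.
      rewrite Rmin_left, Rmax_left; lra.
Qed.

(** For x < 0 the two lower limits differ by the integral of an odd function over
    [x,-x].  With the lower limit x, differentiation at 0 is unproblematic. *)
Lemma volterra_folded (h : R -> R -> C) (f : R -> C) (x : R) :
  cont_dom a h -> cont_supported r f -> Rabs x < a -> volterra a h f x = CInt (folded h f x) x a.
Proof.
  intros Hh Hf Hx. rewrite volterra_folded_Rabs by assumption.
  assert (forall c d, icont (folded h f x) c d) as Hi.
  { intros; apply folded_icont; assumption. }
  destruct (Rle_lt_dec 0 x) as [H0 | H0].
  - rewrite Rabs_pos_eq by exact H0; reflexivity.
  - rewrite Rabs_left by exact H0.
    rewrite <- (CInt_Chasles _ x (- x) a) by apply Hi.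
    enough (CInt (folded h f x) x (- x) = 0) as -> by ring.
    pose proof (CInt_opp_arg (folded h f x) x (- x) (Hi _ _)) as E.
    rewrite Ropp_involutive in E.
    rewrite (CInt_ext _ (fun t => - folded h f x t)%C) in E.
    2: { intros t _. unfold folded. rewrite Ropp_involutive. ring. }
    rewrite CInt_opp in E by apply Hi.
    pose proof (f_equal Re E) as E1. pose proof (f_equal Im E) as E2.
    simpl in E1, E2. apply C_ext; simpl; unfold Re, Im in *; lra.
Qed.

Lemma volterra_zero (h : R -> R -> C) (f : R -> C) (x : R) :
  supported_in r f -> r < Rabs x -> volterra a h f x = 0.
Proof.
  intros Hf Hx. unfold volterra. rewrite !CInt_zero.
  - ring.
  - intros t Ht. rewrite Hf; [ring|].
    unfold Rmin, Rmax in Ht; destruct Rle_dec in Ht; unfold Rabs at 1;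
      destruct Rcase_abs; lra.
  - intros t Ht. rewrite Hf; [ring|].
    unfold Rmin, Rmax in Ht; destruct Rle_dec in Ht; unfold Rabs at 1;
      destruct Rcase_abs; lra.
Qed.

(** The boundary term of the Leibniz rule contains the kernel on the diagonals
    t = x and t = -x, that is [h] on the two axes. *)
Lemma volterra_cderiv (h h1 h2 : R -> R -> C) (f : R -> C) (x : R) :
  partials a h h1 h2 -> cont_dom a h -> cont_dom a h1 -> cont_dom a h2 -> cont_supported r f ->
  cderiv (volterra a h f) x (h 0%R (- x)%R * f (- x)%R - h x 0%R * f x + volterra a (dminus h1 h2) f x)%C.
Proof.
  intros Hp Hh H1 H2 Hf.
  destruct (Rle_lt_dec (Rabs x) r) as [Hx | Hx].
  - assert (Rabs x < a) as Hxa by lra.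
    assert (0 < a - Rabs x) as Hpos by lra.
    assert (cont_dom a (dminus h1 h2)) as Hm by (apply cont_dom_lincomb; assumption).
    apply cderiv_ext_loc with (fun z => CInt (folded h f z) z a).
    { apply (locally_Rabs _ _ (mkposreal _ Hpos)). simpl. intros z Hz. symmetry.
      apply volterra_folded; try assumption. pose proof (Rabs_triang_inv z x). lra. }
    rewrite (volterra_folded _ _ _ Hm Hf Hxa).
    eapply cderiv_eq.
    + apply (CInt_lower_derive a a (folded h f) (folded (dminus h1 h2) f)).
      * exact Hxa.
      * assert (forall y t, Rabs y < a -> cderiv (fun z => kernel h t z * f t)%C y
                  (kernel (dminus h1 h2) t y * f t)) as Hd.
        { intros y t Hy. destruct (Rle_lt_dec (Rabs t) r) as [Ht | Ht].
          - eapply cderiv_eq.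
            + apply cderiv_mult; [|apply cderiv_const].
              apply (kernel_cderiv_2 a); try eassumption. lra.
            + cbv beta; ring.
          - rewrite (proj2 Hf t Ht). rewrite Cmult_0_r.
            apply cderiv_ext_loc with (fun _ => RtoC 0); [|apply cderiv_const].
            apply filter_forall. intros z. ring. }
        intros y t Hy. apply cderiv_minus; apply Hd; exact Hy.
      * intros; apply folded_ccont2; assumption.
      * intros; apply folded_ccont2; assumption.
    + unfold folded at 2. rewrite kernel_diag, kernel_antidiag. ring.
  - destruct (supported_near r x (volterra a h f)) as [eta He].
    + intros y Hy. apply volterra_zero; [apply Hf | exact Hy].
    + exact Hx.
    + apply cderiv_ext_loc with (fun _ => RtoC 0).
      { apply (locally_Rabs _ _ eta). intros y Hy. symmetry. apply He, Hy. }
      eapply cderiv_eq; [apply cderiv_const|].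
      rewrite (volterra_zero (dminus h1 h2) f x (proj2 Hf) Hx).
      rewrite (proj2 Hf x Hx), (proj2 Hf (- x)) by (rewrite Rabs_Ropp; exact Hx).
      ring.
Qed.

(** The primitive is k(t,x) f(t) + k(-t,x) f(-t); it vanishes at t = a because the
    support of [f] is inside ]-a,a[. *)
Lemma volterra_by_parts (h h1 h2 : R -> R -> C) (f f' : R -> C) (x : R) :
  partials a h h1 h2 -> cont_dom a h -> cont_dom a h1 -> cont_dom a h2 ->
  cont_supported r f -> cont_supported r f' -> (forall y, cderiv f y (f' y)) ->
  volterra a h f' x =
    (- (h x 0%R * f x) - h 0%R (- x)%R * f (- x)%R - volterra a (dplus h1 h2) f x)%C.
Proof.
  intros Hp Hh H1 H2 Hf Hf' Hd.
  destruct (Rle_lt_dec (Rabs x) r) as [Hx | Hx].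
  - assert (Rabs x < a) as Hxa by lra.
    assert (0 < a - Rabs x) as Hpos by lra.
    assert (cont_dom a (dplus h1 h2)) as Hm by (apply cont_dom_lincomb; assumption).
    rewrite (volterra_folded _ _ _ Hm Hf Hxa), (volterra_folded _ _ _ Hh Hf' Hxa).
    set (G := fun t => (kernel h t x * f t)%C).
    (* outside the support of f the derivative of G is 0, whatever the kernel *)
    assert (forall t, cderiv G t (kernel (dplus h1 h2) t x * f t + kernel h t x * f' t)) as HG.
    { intros t. unfold G. destruct (Rle_lt_dec (Rabs t) r) as [Ht | Ht].
      - apply (cderiv_mult (fun t => kernel h t x)); [|apply Hd].
        apply (kernel_cderiv_1 a); try assumption. lra.
      - rewrite (proj2 Hf t Ht), (proj2 Hf' t Ht).
        destruct (supported_near r t f (proj2 Hf) Ht) as [eta He].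
        apply cderiv_ext_loc with (fun _ => RtoC 0).
        + apply (locally_Rabs _ _ eta). intros y Hy. rewrite He by exact Hy. ring.
        + eapply cderiv_eq; [apply cderiv_const | ring]. }
    assert (CInt (fun t => folded (dplus h1 h2) f x t + folded h f' x t)%C x a
      = ((G a + G (- a)%R) - (G x + G (- x)%R))%C) as E.
    { apply (CInt_derive (fun t => G t + G (- t)%R)%C).
      - intros t _. unfold folded.
        eapply cderiv_eq.
        + apply cderiv_plus; [apply HG|].
          apply (cderiv_comp G (fun t => - t) t (-1)); [apply HG|].
          auto_derive; [exact I | ring].
        + replace (RtoC (-1)) with (- (1))%C by (apply C_ext; simpl; ring). ring.
      - intros t Ht. apply ccont_plus; apply ccont2_slice, folded_ccont2; assumption. }
    rewrite CInt_plus in E by (apply folded_icont; assumption).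
    unfold G in E. rewrite kernel_diag, kernel_antidiag in E.
    assert (r < Rabs a) as Ha by (rewrite Rabs_pos_eq; pose proof (Rabs_pos x); lra).
    rewrite (proj2 Hf a Ha), (proj2 Hf (- a)) in E by (rewrite Rabs_Ropp; exact Ha).
    set (X := CInt (folded (dplus h1 h2) f x) x a) in *.
    set (Y := CInt (folded h f' x) x a) in *.
    replace Y with ((X + Y) - X)%C by ring. rewrite E. ring.
  - rewrite !volterra_zero; try apply Hf; try apply Hf'; try exact Hx.
    rewrite (proj2 Hf x Hx), (proj2 Hf (- x)) by (rewrite Rabs_Ropp; exact Hx).
    ring.
Qed.

Lemma volterra_lin_fun (h : R -> R -> C) (c : C) (f g : R -> C) (x : R) :
  cont_dom a h -> cont_supported r f -> cont_supported r g ->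
  volterra a h (fun y => c * f y + g y)%C x = (c * volterra a h f x + volterra a h g x)%C.
Proof.
  intros Hh Hf Hg.
  assert (cont_supported r (fun y => c * f y + g y)%C) as Hfg.
  { split.
    - intros y. apply ccont_plus; [apply ccont_mult|]; [apply ccont_const | apply Hf | apply Hg].
    - intros y Hy. rewrite (proj2 Hf y Hy), (proj2 Hg y Hy). ring. }
  destruct (Rle_lt_dec (Rabs x) r) as [Hx | Hx].
  - assert (Rabs x < a) as Hxa by lra. rewrite !volterra_folded by assumption.
    rewrite <- CInt_mult_l by (apply folded_icont; assumption).
    rewrite <- CInt_plus.
    + apply CInt_ext. intros t _. unfold folded. ring.
    + apply icont_mult; [intros ? ?; apply ccont_const | apply folded_icont; assumption].
    + apply folded_icont; assumption.
  - rewrite !volterra_zero; try apply Hf; try apply Hg; try apply Hfg; try exact Hx. ring.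
Qed.

Lemma volterra_lin_kernel (c d : C) (h g : R -> R -> C) (f : R -> C) (x : R) :
  cont_dom a h -> cont_dom a g -> cont_supported r f ->
  volterra a (fun u v => c * h u v + d * g u v)%C f x = (c * volterra a h f x + d * volterra a g f x)%C.
Proof.
  intros Hh Hg Hf.
  assert (cont_dom a (fun u v => c * h u v + d * g u v)%C) as Hhg.
  { apply cont_dom_lincomb; assumption. }
  destruct (Rle_lt_dec (Rabs x) r) as [Hx | Hx].
  - assert (Rabs x < a) as Hxa by lra. rewrite !volterra_folded by assumption.
    rewrite <- !CInt_mult_l by (apply folded_icont; assumption).
    rewrite <- CInt_plus.
    + apply CInt_ext. intros t _. unfold folded, kernel. ring.
    + apply icont_mult; [intros ? ?; apply ccont_const | apply folded_icont; assumption].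
    + apply icont_mult; [intros ? ?; apply ccont_const | apply folded_icont; assumption].
  - rewrite !volterra_zero; try apply Hf; try exact Hx. ring.
Qed.

(** If B bounds the kernel on [-r,r] x [-r,r], the integral of
    2 B M e^{-lam t} over t > |x| is at most (2 B / lam) M e^{-lam |x|}, and
    lam = 4 B + 1 makes the factor at most 1/2. *)
Lemma volterra_contraction (h : R -> R -> C) : 0 < r -> cont_dom a h ->
  exists lam, 0 < lam /\ forall f M, cont_supported r f ->
    (forall x, Cmod (f x) <= M * exp (- lam * Rabs x)) ->
    forall x, Cmod (volterra a h f x) <= M / 2 * exp (- lam * Rabs x).
Proof.
  intros Hr0 Hh.
  destruct (ccont2_bounded (fun x t => kernel h t x) r Hr0) as [B [HB0 HB]].
  { intros x t Hx Ht. apply (kernel_ccont2 a); [exact Hh | lra | lra]. }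
  exists (4 * B + 1). set (lam := 4 * B + 1). assert (0 < lam) as Hlam by (unfold lam; lra).
  split; [exact Hlam|]. intros f M Hf HM x.
  assert (0 <= M) as HM0.
  { specialize (HM 0). rewrite Rabs_R0, Rmult_0_r, exp_0, Rmult_1_r in HM.
    eapply Rle_trans; [apply Cmod_ge_0 | exact HM]. }
  pose proof (exp_pos (- lam * Rabs x)) as Hexp.
  destruct (Rle_lt_dec (Rabs x) r) as [Hx | Hx].
  2: { rewrite volterra_zero; [|apply Hf | exact Hx]. rewrite Cmod_0. nra. }
  assert (Rabs x < a) as Hxa by lra.
  rewrite volterra_folded_Rabs by assumption.
  set (g := fun t => 2 * B * M * exp (- lam * t)).
  assert (forall s t, continuous (fun t => s * exp (- lam * t)) t) as Hgc.
  { intros s t. apply (ex_derive_continuous (V := R_NormedModule)). auto_derive; exact I. }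
  apply Rle_trans with (RInt g (Rabs x) a).
  - apply CInt_norm_le.
    + lra.
    + apply folded_icont; assumption.
    + intros t _. apply Hgc.
    + intros t Ht. unfold g, folded.
      assert (Rabs t = t) as Et by (apply Rabs_pos_eq; pose proof (Rabs_pos x); lra).
      assert (forall s, Rabs s = t ->
        Cmod (kernel h s x * f s) <= B * M * exp (- lam * t)) as Hone.
      { intros s Hs. rewrite Cmod_mult. pose proof (exp_pos (- lam * t)).
        destruct (Rle_lt_dec (Rabs s) r) as [Hsr | Hsr].
        - specialize (HB x s Hx Hsr). specialize (HM s). rewrite Hs in HM.
          rewrite Rmult_assoc. apply Rmult_le_compat; try apply Cmod_ge_0; assumption.
        - rewrite (proj2 Hf s Hsr), Cmod_0, Rmult_0_r.
          apply Rmult_le_pos; [apply Rmult_le_pos|]; lra. }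
      eapply Rle_trans; [apply Cmod_triangle|]. rewrite Cmod_opp.
      pose proof (Hone t Et). pose proof (Hone (- t)). rewrite Rabs_Ropp in H0.
      specialize (H0 Et). lra.
  - set (c := 2 * B * M / lam).
    assert (RInt g (Rabs x) a = c * exp (- lam * Rabs x) - c * exp (- lam * a)) as ->.
    { apply (is_RInt_unique (V := R_CompleteNormedModule)).
      replace (c * exp (- lam * Rabs x) - c * exp (- lam * a)) with
        (minus (- c * exp (- lam * a)) (- c * exp (- lam * Rabs x)))
        by (unfold minus, plus, opp; simpl; ring).
      apply (is_RInt_derive (V := R_CompleteNormedModule) (fun t => - c * exp (- lam * t))).
      - intros t _. unfold g, c. auto_derive; [exact I | field; lra].
      - intros t _. apply Hgc. }
    assert (0 <= c) as Hc0.
    { unfold c. apply Rdiv_le_0_compat; [|exact Hlam]. repeat apply Rmult_le_pos; lra. }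
    assert (c <= M / 2) as Hc.
    { unfold c. apply Rmult_le_reg_r with lam; [exact Hlam|].
      replace (2 * B * M / lam * lam) with (2 * B * M) by (field; lra).
      unfold lam. nra. }
    pose proof (exp_pos (- lam * a)). nra.
Qed.

Lemma volterra_sup (h : R -> R -> C) : 0 < r -> cont_dom a h ->
  exists A, 0 <= A /\ forall f M, cont_supported r f -> (forall x, Cmod (f x) <= M) ->
    forall x, Cmod (volterra a h f x) <= A * M.
Proof.
  intros Hr0 Hh. destruct (volterra_contraction h Hr0 Hh) as [lam [Hlam HV]].
  exists (exp (lam * r) / 2). split; [pose proof (exp_pos (lam * r)); lra|].
  intros f M Hf HM x.
  assert (0 <= M) as HM0 by (eapply Rle_trans; [apply Cmod_ge_0 | apply (HM 0)]).
  eapply Rle_trans; [apply (HV f (M * exp (lam * r)) Hf)|].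
  - apply weight_of_sup; [exact Hlam | apply Hf | exact HM].
  - pose proof (weight_le_1 lam x Hlam) as He.
    pose proof (exp_pos (lam * r)). pose proof (exp_pos (- lam * Rabs x)).
    assert (0 <= M * exp (lam * r) / 2) by (apply Rdiv_le_0_compat; [nra | lra]).
    nra.
Qed.

End Volterra.

(** * Bounds on derivatives *)

(** [M] is an upper bound of the C^n norm.  The derivatives are existentially
    quantified, so that they can be given by formulas instead of by [CDerive_n]. *)
Fixpoint diff_bounded (n : nat) (f : R -> C) (M : R) : Prop :=
  (forall x, ccont f x) /\ (forall x, Cmod (f x) <= M) /\
  match n with
  | O => True
  | S m => exists f', (forall x, cderiv f x (f' x)) /\ diff_bounded m f' M
  end.

Lemma diff_bounded_ccont (n : nat) (f : R -> C) (M : R) : diff_bounded n f M -> forall x, ccont f x.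
Proof. destruct n; intros [Hc _]; exact Hc. Qed.

Lemma diff_bounded_le (n : nat) (f : R -> C) (M : R) : diff_bounded n f M -> forall x, Cmod (f x) <= M.
Proof. destruct n; intros [_ [Hb _]]; exact Hb. Qed.

Lemma diff_bounded_weaken (n : nat) (f : R -> C) (M M' : R) : diff_bounded n f M -> M <= M' -> diff_bounded n f M'.
Proof.
  revert f. induction n as [|n IH]; intros f [Hc [Hb Hd]] HM; simpl;
    (split; [exact Hc | split; [intros x; specialize (Hb x); lra|]]).
  - exact I.
  - destruct Hd as [f' [Hd Hf']]. exists f'. split; [exact Hd | apply IH; assumption].
Qed.

Lemma diff_bounded_S (n : nat) (f f' : R -> C) (M M' K : R) :
  (forall x, cderiv f x (f' x)) -> (forall x, Cmod (f x) <= M) -> diff_bounded n f' M' ->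
  M <= K -> M' <= K -> diff_bounded (S n) f K.
Proof.
  intros Hd Hb Hf' HM HM'. split; [|split].
  - intros x. eapply cderiv_ccont, Hd.
  - intros x. specialize (Hb x). lra.
  - exists f'. split; [exact Hd|]. eapply diff_bounded_weaken; eassumption.
Qed.

Lemma diff_bounded_pred (n : nat) (f : R -> C) (M : R) : diff_bounded (S n) f M -> diff_bounded n f M.
Proof.
  revert f. induction n as [|n IH]; intros f [Hc [Hb [f' [Hd Hf']]]].
  - repeat (split; try assumption).
  - split; [exact Hc|]. split; [exact Hb|]. exists f'. split; [exact Hd | apply IH, Hf'].
Qed.

Lemma diff_bounded_plus (n : nat) (f g : R -> C) (M N : R) :
  diff_bounded n f M -> diff_bounded n g N -> diff_bounded n (fun x => f x + g x)%C (M + N).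
Proof.
  revert f g. induction n as [|n IH]; intros f g [Hc [Hb Hd]] [Gc [Gb Gd]]; simpl;
    (split; [intros x; apply ccont_plus; auto | split;
      [intros x; eapply Rle_trans; [apply Cmod_triangle | apply Rplus_le_compat; auto]|]]).
  - exact I.
  - destruct Hd as [f' [Hd Hf']], Gd as [g' [Gd Gf']].
    exists (fun x => f' x + g' x)%C. split; [intros; apply cderiv_plus; auto | auto].
Qed.

Lemma diff_bounded_opp (n : nat) (f : R -> C) (M : R) : diff_bounded n f M -> diff_bounded n (fun x => - f x)%C M.
Proof.
  revert f. induction n as [|n IH]; intros f [Hc [Hb Hd]]; simpl;
    (split; [intros x; apply ccont_opp; auto | split; [intros x; rewrite Cmod_opp; auto|]]).
  - exact I.
  - destruct Hd as [f' [Hd Hf']]. exists (fun x => - f' x)%C.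
    split; [intros; apply cderiv_opp; auto | auto].
Qed.

Lemma diff_bounded_reflect (n : nat) (f : R -> C) (M : R) : diff_bounded n f M -> diff_bounded n (fun x => f (- x)%R) M.
Proof.
  revert f. induction n as [|n IH]; intros f [Hc [Hb Hd]]; simpl;
    (split; [intros x; apply (ccont_comp f (fun x => - x));
               [apply (continuous_opp (fun t : R => t)), continuous_id | auto]
            | split; [auto|]]).
  - exact I.
  - destruct Hd as [f' [Hd Hf']]. exists (fun x => - f' (- x)%R)%C.
    split; [|apply diff_bounded_opp, IH, Hf'].
    intros x. eapply cderiv_eq.
    + apply (cderiv_comp f (fun x => - x) x (-1)); [apply Hd | auto_derive; [exact I | ring]].
    + apply C_ext; simpl; unfold Re, Im; ring.
Qed.

Lemma cderiv_supported (r : R) (f f' : R -> C) :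
  (forall x, cderiv f x (f' x)) -> supported_in r f -> supported_in r f'.
Proof.
  intros Hd Hf x Hx. destruct (supported_near r x f Hf Hx) as [eta He].
  rewrite <- (cderiv_CDerive _ _ _ (Hd x)). apply cderiv_CDerive.
  apply cderiv_ext_loc with (fun _ => RtoC 0); [|apply cderiv_const].
  apply (locally_Rabs _ _ eta). intros y Hy. symmetry; apply He, Hy.
Qed.

Lemma ccont_bounded (r : R) (b : R -> C) : 0 < r ->
  (forall x, Rabs x <= r -> ccont b x) ->
  exists B, 0 <= B /\ forall x, Rabs x <= r -> Cmod (b x) <= B.
Proof.
  intros Hr Hb. destruct (ccont2_bounded (fun x _ => b x) r Hr) as [B [HB0 HB]].
  { intros x y Hx _. apply ccont2_fst_only, Hb, Hx. }
  exists B. split; [exact HB0|]. intros x Hx. apply (HB x x Hx Hx).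
Qed.

Section Estimates.

Context (a r : R) (Hr0 : 0 < r) (Hr : r < a).

Lemma inside (x : R) : Rabs x <= r -> interval a x.
Proof. intros Hx. apply interval_Rabs. lra. Qed.

Lemma mult_supported (b f : R -> C) : supported_in r f -> supported_in r (fun x => b x * f x)%C.
Proof. intros Hf x Hx. rewrite (Hf x Hx). ring. Qed.

Lemma mult_cderiv (b b' f f' : R -> C) (x : R) :
  (forall x, interval a x -> cderiv b x (b' x)) ->
  supported_in r f -> (forall x, cderiv f x (f' x)) ->
  cderiv (fun x => b x * f x)%C x (b' x * f x + b x * f' x)%C.
Proof.
  intros Hb Hf Hd. destruct (Rle_lt_dec (Rabs x) r) as [Hx | Hx].
  - apply cderiv_mult; [apply Hb, inside, Hx | apply Hd].
  - destruct (supported_near r x f Hf Hx) as [eta He].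
    apply cderiv_ext_loc with (fun _ => RtoC 0).
    + apply (locally_Rabs _ _ eta). intros y Hy. rewrite He by exact Hy. ring.
    + eapply cderiv_eq; [apply cderiv_const|].
      rewrite (Hf x Hx), (cderiv_supported r f f' Hd Hf x Hx). ring.
Qed.

Lemma mult_ccont (b f : R -> C) (x : R) :
  (forall x, interval a x -> ccont b x) -> cont_supported r f -> ccont (fun x => b x * f x)%C x.
Proof.
  intros Hb [Hc Hf]. destruct (Rle_lt_dec (Rabs x) r) as [Hx | Hx].
  - apply ccont_mult; [apply Hb, inside, Hx | apply Hc].
  - destruct (supported_near r x f Hf Hx) as [eta He].
    apply ccont_ext_loc with (fun _ => RtoC 0); [|apply ccont_const].
    apply (locally_Rabs _ _ eta). intros y Hy. rewrite He by exact Hy. ring.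
Qed.

(** [b] is controlled on ]-a,a[ only, which contains the support of [f]. *)
Lemma mult_diff_bounded (n : nat) (b : R -> C) : smooth1 a b ->
  exists A, 0 <= A /\ forall f M, supported_in r f -> diff_bounded n f M ->
    diff_bounded n (fun x => b x * f x)%C (A * M).
Proof.
  assert (forall b, smooth1 a b -> exists A, 0 <= A /\ forall f M, supported_in r f ->
    (forall x, Cmod (f x) <= M) -> forall x, Cmod (b x * f x) <= A * M) as Hsup.
  { intros c Hc. destruct (ccont_bounded r c Hr0) as [B [HB0 HB]].
    { intros x Hx. eapply smooth1_ccont; [exact Hc | apply inside, Hx]. }
    exists B. split; [exact HB0|]. intros f M Hf HM x.
    rewrite Cmod_mult. destruct (Rle_lt_dec (Rabs x) r) as [Hx | Hx].
    - apply Rmult_le_compat; try apply Cmod_ge_0; auto.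
    - rewrite (Hf x Hx), Cmod_0, Rmult_0_r. apply Rmult_le_pos; [exact HB0|].
      eapply Rle_trans; [apply Cmod_ge_0 | apply (HM x)]. }
  revert b. induction n as [|n IH]; intros b Hb.
  - destruct (Hsup b Hb) as [A [HA0 HA]]. exists A. split; [exact HA0|].
    intros f M Hf [Hc [HM _]]. split; [|split; [apply HA; assumption | exact I]].
    intros x. apply mult_ccont; [|split; assumption].
    intros; eapply smooth1_ccont; eassumption.
  - destruct (Hsup b Hb) as [A [HA0 HA]]. destruct (IH b Hb) as [A1 [HA1 Hn]].
    destruct Hb as [b' Hd Hb']. destruct (IH b' Hb') as [A2 [HA2 Hn']].
    exists (A + (A1 + A2)). split; [lra|]. intros f M Hf HfM.
    assert (0 <= M) as HM.
    { eapply Rle_trans; [apply Cmod_ge_0 | apply (diff_bounded_le _ _ _ HfM 0)]. }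
    pose proof (diff_bounded_pred _ _ _ HfM) as HfM'. destruct HfM as [Hc [Hle [f' [Hfd Hf']]]].
    apply diff_bounded_S with (f' := fun x => (b' x * f x + b x * f' x)%C)
      (M := A * M) (M' := A2 * M + A1 * M).
    + intros x. apply mult_cderiv; assumption.
    + apply HA; assumption.
    + apply diff_bounded_plus; [apply Hn' | apply Hn]; try assumption.
      eapply cderiv_supported; eassumption.
    + nra.
    + nra.
Qed.

Lemma volterra_cont_supported (h : R -> R -> C) (f : R -> C) :
  smooth2 a h -> cont_supported r f -> cont_supported r (volterra a h f).
Proof.
  intros [h1 h2 Hc Hp Hs1 Hs2] Hf. split.
  - intros x. eapply cderiv_ccont, (volterra_cderiv a r Hr h h1 h2); try assumption;
      apply smooth2_cont; assumption.
  - intros x Hx. apply (volterra_zero a r Hr); [apply Hf | exact Hx].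
Qed.

(** In the formula for the derivative of the Volterra operator only [f] itself
    occurs, so [n] derivatives of [f] give [n] derivatives of that formula.  This
    is the induction step of [volterra_diff_bounded], which in turn provides the
    assumption for [volterra_gain]. *)
Lemma volterra_gain_of (n : nat) (h : R -> R -> C) :
  (forall g, smooth2 a g -> exists A, 0 <= A /\ forall f M, supported_in r f -> diff_bounded n f M ->
     diff_bounded n (volterra a g f) (A * M)) ->
  smooth2 a h ->
  exists A, 0 <= A /\ forall f M, supported_in r f -> diff_bounded n f M ->
    diff_bounded (S n) (volterra a h f) (A * M).
Proof.
  intros HV Hh.
  destruct (volterra_sup a r Hr h Hr0 (smooth2_cont a h Hh)) as [A [HA0 HA]].
  destruct (mult_diff_bounded n _ (smooth2_diag a h Hh)) as [A1 [HA1 H1]].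
  destruct (mult_diff_bounded n _ (smooth2_antidiag a h Hh)) as [A2 [HA2 H2]].
  destruct Hh as [h1 h2 Hc Hp Hs1 Hs2].
  destruct (HV (dminus h1 h2)) as [A3 [HA3 H3]].
  { apply smooth2_lincomb; assumption. }
  exists (A + (A1 + A2 + A3)). split; [lra|]. intros f M Hf HfM.
  assert (0 <= M) as HM.
  { eapply Rle_trans; [apply Cmod_ge_0 | apply (diff_bounded_le _ _ _ HfM 0)]. }
  assert (cont_supported r f) as Hfs by (split; [apply (diff_bounded_ccont _ _ _ HfM) | exact Hf]).
  apply diff_bounded_S with (M := A * M) (M' := A2 * M + A1 * M + A3 * M)
    (f' := fun x => (h 0%R (- x)%R * f (- x)%R + - (h x 0%R * f x) + volterra a (dminus h1 h2) f x)%C).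
  - intros x. apply (volterra_cderiv a r Hr); try assumption; apply smooth2_cont; assumption.
  - apply HA; [exact Hfs | apply (diff_bounded_le _ _ _ HfM)].
  - apply diff_bounded_plus; [apply diff_bounded_plus; [|apply diff_bounded_opp]|].
    + apply (H2 (fun x => f (- x)%R)).
      * intros x Hx. apply Hf. rewrite Rabs_Ropp; exact Hx.
      * apply diff_bounded_reflect, HfM.
    + apply H1; assumption.
    + apply H3; assumption.
  - nra.
  - nra.
Qed.

Lemma volterra_diff_bounded (n : nat) (h : R -> R -> C) : smooth2 a h ->
  exists A, 0 <= A /\ forall f M, supported_in r f -> diff_bounded n f M -> diff_bounded n (volterra a h f) (A * M).
Proof.
  revert h. induction n as [|n IH]; intros h Hh.
  - destruct (volterra_sup a r Hr h Hr0 (smooth2_cont a h Hh)) as [A [HA0 HA]].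
    exists A. split; [exact HA0|]. intros f M Hf [Hc [HM _]].
    split; [|split; [apply HA; [split|]; assumption | exact I]].
    apply volterra_cont_supported; [exact Hh | split; assumption].
  - destruct (volterra_gain_of n h IH Hh) as [A [HA0 HA]]. exists A. split; [exact HA0|].
    intros f M Hf HfM. apply HA; [exact Hf | apply diff_bounded_pred, HfM].
Qed.

Lemma volterra_gain (n : nat) (h : R -> R -> C) : smooth2 a h ->
  exists A, 0 <= A /\ forall f M, supported_in r f -> diff_bounded n f M ->
    diff_bounded (S n) (volterra a h f) (A * M).
Proof. intros Hh. apply volterra_gain_of; [intros; apply volterra_diff_bounded; assumption | exact Hh]. Qed.

End Estimates.

(** * Test functions and bounds on derivatives *)

Lemma CDerive_eq (f f' : R -> C) : (forall x, cderiv f x (f' x)) -> CDerive f = f'.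
Proof. intros Hd. extensionality x. apply cderiv_CDerive, Hd. Qed.

Lemma diff_bounded_CDerive_n (n : nat) (f : R -> C) (M : R) : diff_bounded n f M ->
  forall k x, (k <= n)%nat -> Cmod (CDerive_n f k x) <= M.
Proof.
  revert f. induction n as [|n IH]; intros f Hf k x Hk.
  - replace k with 0%nat by lia. apply (diff_bounded_le _ _ _ Hf).
  - destruct k as [|k]; [apply (diff_bounded_le _ _ _ Hf)|].
    destruct Hf as [_ [_ [f' [Hd Hf']]]].
    unfold CDerive_n. rewrite Nat.iter_succ_r, (CDerive_eq f f' Hd).
    apply IH; [exact Hf' | lia].
Qed.

Lemma diff_bounded_ex_derive (n : nat) (f : R -> C) (M : R) (x : R) : diff_bounded (S n) f M ->
  ex_derive (V := C_R_NormedModule) (CDerive_n f n) x.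
Proof.
  revert f. induction n as [|n IH]; intros f [_ [_ [f' [Hd Hf']]]].
  - eapply cderiv_ex_derive, Hd.
  - unfold CDerive_n. rewrite Nat.iter_succ_r, (CDerive_eq f f' Hd). apply IH, Hf'.
Qed.

Lemma smooth_on_tail (f : R -> C) :
  smooth_on (fun _ => True) f -> smooth_on (fun _ => True) (CDerive f).
Proof.
  intros Hf n x _. unfold CDerive_n. rewrite <- Nat.iter_succ_r. apply (Hf (S n) x I).
Qed.

Lemma smooth_diff_bounded (n : nat) (f : R -> C) (M : R) : smooth_on (fun _ => True) f ->
  (forall k x, (k <= n)%nat -> Cmod (CDerive_n f k x) <= M) -> diff_bounded n f M.
Proof.
  revert f. induction n as [|n IH]; intros f Hs Hb;
    assert (forall x, cderiv f x (CDerive f x)) as Hd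
      by (intros x; apply ex_derive_cderiv, (Hs 0%nat x I));
    (split; [intros x; eapply cderiv_ccont, Hd
            | split; [intros x; apply (Hb 0%nat x); lia|]]).
  - exact I.
  - exists (CDerive f). split; [exact Hd|]. apply IH.
    + apply smooth_on_tail, Hs.
    + intros k x Hk. unfold CDerive_n. rewrite <- Nat.iter_succ_r. apply (Hb (S k) x). lia.
Qed.

Lemma test_of_diff_bounded (a r : R) (f : R -> C) : 0 < r < a -> supported_in r f ->
  (forall n, exists M, diff_bounded n f M) -> test a f.
Proof.
  intros Hr Hf Hn. split.
  - intros n x _. destruct (Hn (S n)) as [M HM]. eapply diff_bounded_ex_derive, HM.
  - exists r. split; assumption.
Qed.

Lemma diff_bounded_of_test (n : nat) (a r : R) (f : R -> C) : 0 < r -> test a f -> supported_in r f ->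
  exists M, diff_bounded n f M.
Proof.
  intros Hr [Hs _]. revert f Hs. induction n as [|n IH]; intros f Hs Hf;
    assert (forall x, cderiv f x (CDerive f x)) as Hd
      by (intros x; apply ex_derive_cderiv, (Hs 0%nat x I));
    destruct (ccont_bounded r f Hr) as [B [HB0 HB]];
    try (intros x _; eapply cderiv_ccont, Hd);
    assert (forall x, Cmod (f x) <= B) as HB'
      by (intros x; destruct (Rle_lt_dec (Rabs x) r) as [Hx | Hx];
          [auto | rewrite (Hf x Hx), Cmod_0; exact HB0]).
  - exists B. split; [intros x; eapply cderiv_ccont, Hd | split; [exact HB' | exact I]].
  - destruct (IH (CDerive f)) as [M HM].
    + apply smooth_on_tail, Hs.
    + eapply cderiv_supported; eassumption.
    + exists (Rmax B M). eapply diff_bounded_S; try eassumption; [apply Rmax_l | apply Rmax_r].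
Qed.

(** * The Neumann series *)

Fixpoint partial_sum (u : nat -> R) (n : nat) : R :=
  match n with O => 0 | S m => partial_sum u m + u m end.

Lemma geom_series_tail (u : nat -> R) (B : R) (n : nat) :
  (forall k, Rabs (u k) <= B * (1 / 2) ^ k) ->
  Rabs (Series u - partial_sum u n) <= 2 * B * (1 / 2) ^ n.
Proof.
  intros Hu.
  assert (Rabs (1 / 2) < 1) as Hhalf by (rewrite Rabs_pos_eq; lra).
  assert (forall m, ex_series (fun k => (B * (1 / 2) ^ m) * (1 / 2) ^ k)) as Hgeo.
  { intros m. apply (ex_series_scal (V := R_NormedModule)), ex_series_geom, Hhalf. }
  assert (forall m k, Rabs (u (m + k)%nat) <= (B * (1 / 2) ^ m) * (1 / 2) ^ k) as Hb.
  { intros m k. rewrite Rmult_assoc, <- pow_add. apply Hu. }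
  assert (forall m, ex_series (fun k => u (m + k)%nat)) as Hex.
  { intros m. apply (ex_series_le (V := R_CompleteNormedModule)) with (2 := Hgeo m), Hb. }
  assert (forall m, Series u - partial_sum u m = Series (fun k => u (m + k)%nat)) as E.
  { induction m as [|m IH]; simpl.
    - rewrite Rminus_0_r. reflexivity.
    - replace (Series u - (partial_sum u m + u m)) with
        (Series u - partial_sum u m - u m) by ring.
      rewrite IH, (Series_incr_1 _ (Hex m)), Nat.add_0_r.
      replace (u m + Series (fun k => u (m + S k)%nat) - u m) with
        (Series (fun k => u (m + S k)%nat)) by ring.
      apply Series_ext. intros k. f_equal; lia. }
  rewrite E. eapply Rle_trans.
  - apply Series_Rabs. apply (ex_series_le (V := R_CompleteNormedModule)) with (2 := Hgeo n).
    intros k. unfold norm; simpl. unfold abs; simpl. rewrite Rabs_Rabsolu. apply Hb.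
  - eapply Rle_trans.
    + apply Series_le with (2 := Hgeo n). intros k. split; [apply Rabs_pos | apply Hb].
    + rewrite Series_scal_l, Series_geom by exact Hhalf.
      apply Req_le. field.
Qed.

Lemma small_zero (z : C) (B : R) : (forall n, Cmod z <= B * (1 / 2) ^ n) -> z = 0.
Proof.
  intros Hz. apply Cmod_eq_0. apply Rle_antisym; [|apply Cmod_ge_0].
  apply Rnot_lt_le. intros Hpos.
  assert (0 < B) as HB by (specialize (Hz O); simpl in Hz; lra).
  destruct (pow_lt_1_zero (1 / 2)) with (y := Cmod z / B) as [N HN].
  - rewrite Rabs_pos_eq; lra.
  - apply Rdiv_lt_0_compat; assumption.
  - specialize (HN N (le_n N)). specialize (Hz N).
    pose proof (Rle_abs ((1 / 2) ^ N)).
    assert ((1 / 2) ^ N < Cmod z / B) as H1 by lra.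
    apply (Rmult_lt_compat_l B) in H1; [|exact HB].
    replace (B * (Cmod z / B)) with (Cmod z) in H1 by (field; lra). lra.
Qed.

Lemma ccont_uniform_limit (f : R -> C) (x : R) :
  (forall eps : posreal, exists g, ccont g x /\ forall y, Cmod (f y - g y) <= eps) ->
  ccont f x.
Proof.
  intros Hf.
  assert (forall p : C -> R, (forall z w, Rabs (p z - p w) <= Cmod (z - w)) ->
    (forall g, ccont g x -> continuous (fun t => p (g t)) x) ->
    continuous (fun t => p (f t)) x) as Hp.
  { intros p Hlip Hcont. apply (proj2 (filterlim_locally _ _)). intros eps.
    assert (0 < eps / 4) as He by (pose proof (cond_pos eps); lra).
    destruct (Hf (mkposreal _ He)) as [g [Hg Hfg]]. simpl in Hfg.
    destruct (proj1 (filterlim_locally _ _) (Hcont g Hg) (mkposreal _ He)) as [d Hd].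
    exists d. intros y Hy. specialize (Hd y Hy).
    assert (Rabs (p (g y) - p (g x)) < eps / 4) as H1 by exact Hd.
    pose proof (Rle_trans _ _ _ (Hlip (f y) (g y)) (Hfg y)) as H2.
    pose proof (Rle_trans _ _ _ (Hlip (f x) (g x)) (Hfg x)) as H3.
    change (Rabs (p (f y) - p (f x)) < eps).
    pose proof (cond_pos eps).
    apply Rabs_def2 in H1. apply Rabs_le_between in H2. apply Rabs_le_between in H3.
    apply Rabs_def1; lra. }
  split; apply Hp.
  - intros z w. eapply Rle_trans; [|apply (re_le_Cmod (z - w))]. right. reflexivity.
  - intros g Hg; apply Hg.
  - intros z w. eapply Rle_trans; [|apply Rmax_Cmod]. apply Rmax_r.
  - intros g Hg; apply Hg.
Qed.

Definition Vneg (a : R) (h : R -> R -> C) (f : R -> C) (x : R) : C := (- volterra a h f x)%C.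

Definition neumann_term (a : R) (h : R -> R -> C) (f : R -> C) (n : nat) : R -> C :=
  Nat.iter n (Vneg a h) f.

Definition neumann (a : R) (h : R -> R -> C) (f : R -> C) (x : R) : C :=
  (Series (fun n => Re (neumann_term a h f n x)),
   Series (fun n => Im (neumann_term a h f n x))).

Fixpoint neumann_sum (a : R) (h : R -> R -> C) (f : R -> C) (n : nat) (x : R) : C :=
  match n with
  | O => 0
  | S m => neumann_sum a h f m x + neumann_term a h f m x
  end.

Lemma cont_supported_plus (r : R) (f g : R -> C) : cont_supported r f -> cont_supported r g ->
  cont_supported r (fun x => f x + g x)%C.
Proof.
  intros [Hf Hf0] [Hg Hg0]. split.
  - intros x. apply ccont_plus; auto.
  - intros x Hx. rewrite (Hf0 x Hx), (Hg0 x Hx). ring.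
Qed.

Lemma cont_supported_opp (r : R) (f : R -> C) : cont_supported r f -> cont_supported r (fun x => - f x)%C.
Proof.
  intros [Hf Hf0]. split.
  - intros x. apply ccont_opp; auto.
  - intros x Hx. rewrite (Hf0 x Hx). ring.
Qed.

Section Neumann.

Context (a r : R) (Hr0 : 0 < r) (Hr : r < a) (h : R -> R -> C) (Hh : smooth2 a h).

Lemma neumann_term_cont_supported (f : R -> C) (n : nat) : cont_supported r f -> cont_supported r (neumann_term a h f n).
Proof.
  intros Hf. induction n as [|n IH]; [exact Hf|].
  apply cont_supported_opp, (volterra_cont_supported a r Hr); assumption.
Qed.

Lemma neumann_sum_cont_supported (f : R -> C) (n : nat) : cont_supported r f -> cont_supported r (neumann_sum a h f n).
Proof.
  intros Hf. induction n as [|n IH].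
  - split; [intros; apply ccont_const | intros ? _; reflexivity].
  - apply cont_supported_plus; [exact IH | apply neumann_term_cont_supported, Hf].
Qed.

Lemma volterra_plus (f g : R -> C) (x : R) : cont_supported r f -> cont_supported r g ->
  volterra a h (fun y => f y + g y)%C x = (volterra a h f x + volterra a h g x)%C.
Proof.
  intros Hf Hg. pose proof (volterra_lin_fun a r Hr h 1 f g x (smooth2_cont _ _ Hh) Hf Hg) as E.
  rewrite Cmult_1_l in E. rewrite <- E. f_equal. extensionality y. ring.
Qed.

Lemma volterra_0 (x : R) : volterra a h (fun _ => RtoC 0) x = 0.
Proof. unfold volterra. rewrite !CInt_zero; [ring | |]; intros; ring. Qed.

Lemma volterra_opp (f : R -> C) (x : R) : cont_supported r f ->
  volterra a h (fun y => - f y)%C x = (- volterra a h f x)%C.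
Proof.
  intros Hf.
  assert (cont_supported r (fun _ => RtoC 0)) as H0.
  { split; [intros; apply ccont_const | intros ? _; reflexivity]. }
  pose proof (volterra_lin_fun a r Hr h (- (1)) f _ x (smooth2_cont _ _ Hh) Hf H0) as E.
  rewrite volterra_0 in E.
  replace (fun y => - f y)%C with (fun y => - (1) * f y + 0)%C by (extensionality y; ring).
  rewrite E. ring.
Qed.

Lemma neumann_sum_eq (f : R -> C) (n : nat) (x : R) : cont_supported r f ->
  neumann_sum a h f (S n) x = (f x - volterra a h (neumann_sum a h f n) x)%C.
Proof.
  intros Hf. induction n as [|n IH].
  - simpl. rewrite volterra_0. ring.
  - change (neumann_sum a h f (S (S n)) x) with
      (neumann_sum a h f (S n) x + neumann_term a h f (S n) x)%C.
    rewrite IH. 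
    change (volterra a h (neumann_sum a h f (S n)) x) with
      (volterra a h (fun y => neumann_sum a h f n y + neumann_term a h f n y)%C x).
    rewrite volterra_plus by (apply neumann_sum_cont_supported || apply neumann_term_cont_supported; exact Hf).
    change (neumann_term a h f (S n) x) with (- volterra a h (neumann_term a h f n) x)%C. ring.
Qed.

Context (lam : R) (Hlam : 0 < lam)
  (HV : forall f M, cont_supported r f ->
    (forall x, Cmod (f x) <= M * exp (- lam * Rabs x)) ->
    forall x, Cmod (volterra a h f x) <= M / 2 * exp (- lam * Rabs x)).

Lemma neumann_term_bound (f : R -> C) (M : R) (n : nat) : cont_supported r f ->
  (forall x, Cmod (f x) <= M * exp (- lam * Rabs x)) ->
  forall x, Cmod (neumann_term a h f n x) <= M * (1 / 2) ^ n * exp (- lam * Rabs x).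
Proof.
  intros Hf HM. induction n as [|n IH]; intros x.
  - simpl. rewrite Rmult_1_r. apply HM.
  - change (neumann_term a h f (S n) x) with (- volterra a h (neumann_term a h f n) x)%C.
    rewrite Cmod_opp. eapply Rle_trans.
    + apply (HV _ _ (neumann_term_cont_supported f n Hf) IH).
    + apply Req_le. simpl. field.
Qed.

(** Each component is dominated by a geometric series of ratio 1/2; the two
    components together give the factor 4. *)
Lemma neumann_tail (f : R -> C) (M : R) (n : nat) : cont_supported r f ->
  (forall x, Cmod (f x) <= M * exp (- lam * Rabs x)) ->
  forall x, Cmod (neumann a h f x - neumann_sum a h f n x)
    <= 4 * M * (1 / 2) ^ n * exp (- lam * Rabs x).
Proof.
  intros Hf HM x.
  assert (forall k, Rabs (Re (neumann_term a h f k x))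
    <= M * exp (- lam * Rabs x) * (1 / 2) ^ k) as B1.
  { intros k. eapply Rle_trans; [apply re_le_Cmod|].
    eapply Rle_trans; [apply (neumann_term_bound f M k Hf HM)|]. right; ring. }
  assert (forall k, Rabs (Im (neumann_term a h f k x))
    <= M * exp (- lam * Rabs x) * (1 / 2) ^ k) as B2.
  { intros k. eapply Rle_trans; [eapply Rle_trans; [apply Rmax_r | apply Rmax_Cmod]|].
    eapply Rle_trans; [apply (neumann_term_bound f M k Hf HM)|]. right; ring. }
  assert (forall n, Re (neumann_sum a h f n x)
    = partial_sum (fun n => Re (neumann_term a h f n x)) n /\
    Im (neumann_sum a h f n x)
    = partial_sum (fun n => Im (neumann_term a h f n x)) n) as E.
  { induction n0 as [|m [IH1 IH2]]; [split; reflexivity|].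
    simpl. rewrite <- IH1, <- IH2. split; reflexivity. }
  eapply Rle_trans; [apply Cmod_le_components|].
  pose proof (geom_series_tail _ _ n B1) as T1. pose proof (geom_series_tail _ _ n B2) as T2.
  rewrite <- (proj1 (E n)) in T1. rewrite <- (proj2 (E n)) in T2.
  replace (4 * M * (1 / 2) ^ n * exp (- lam * Rabs x)) with
    (2 * (M * exp (- lam * Rabs x)) * (1 / 2) ^ n +
     2 * (M * exp (- lam * Rabs x)) * (1 / 2) ^ n) by ring.
  apply Rplus_le_compat; [exact T1 | exact T2].
Qed.

Lemma cont_supported_weight (f : R -> C) : cont_supported r f -> exists M, 0 <= M /\
  (forall x, Cmod (f x) <= M * exp (- lam * Rabs x)).
Proof.
  intros [Hf Hf0]. destruct (ccont_bounded r f Hr0 (fun x _ => Hf x)) as [B [HB0 HB]].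
  exists (B * exp (lam * r)). split; [pose proof (exp_pos (lam * r)); nra|].
  apply weight_of_sup; [exact Hlam | exact Hf0 |].
  intros x. destruct (Rle_lt_dec (Rabs x) r) as [Hx | Hx]; [auto|].
  rewrite (Hf0 x Hx), Cmod_0. exact HB0.
Qed.

Lemma neumann_cont_supported (f : R -> C) : cont_supported r f -> cont_supported r (neumann a h f).
Proof.
  intros Hf. destruct (cont_supported_weight f Hf) as [M [HM0 HM]]. split.
  - intros x. apply ccont_uniform_limit. intros eps.
    destruct (pow_lt_1_zero (1 / 2)) with (y := eps / (4 * M + 1)) as [N HN].
    { rewrite Rabs_pos_eq; lra. }
    { apply Rdiv_lt_0_compat; [apply cond_pos | lra]. }
    specialize (HN N (le_n N)). pose proof (Rle_abs ((1 / 2) ^ N)).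
    assert (0 < (1 / 2) ^ N) as Hp by (apply pow_lt; lra).
    exists (neumann_sum a h f N). split; [apply neumann_sum_cont_supported, Hf|].
    intros y. eapply Rle_trans; [apply (neumann_tail f M N Hf HM)|].
    assert ((1 / 2) ^ N * (4 * M + 1) < eps) as H1.
    { replace (pos eps) with (eps / (4 * M + 1) * (4 * M + 1)) by (field; lra).
      apply Rmult_lt_compat_r; lra. }
    pose proof (weight_le_1 lam y Hlam). pose proof (exp_pos (- lam * Rabs y)).
    assert (0 <= 4 * M * (1 / 2) ^ N) by nra. nra.
  - intros x Hx.
    assert (forall n, neumann_term a h f n x = 0) as E.
    { intros n. apply (neumann_term_cont_supported f n Hf), Hx. }
    unfold neumann. apply C_ext; simpl;
      (rewrite (Series_ext _ (fun n => 0 * 0)) by (intros n; rewrite E; simpl; ring));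
      rewrite Series_scal_l; ring.
Qed.

(** The partial sums satisfy s_{n+1} = f - V s_n, and V (R f - s_n) tends to 0 by
    the contraction property, so the limit satisfies R f = f - V (R f). *)
Lemma neumann_solves (f : R -> C) (x : R) : cont_supported r f ->
  (neumann a h f x + volterra a h (neumann a h f) x)%C = f x.
Proof.
  intros Hf. destruct (cont_supported_weight f Hf) as [M [HM0 HM]].
  assert (forall z w : C, (z - w)%C = 0 -> z = w) as Hsub.
  { intros z w Hz. replace z with (z - w + w)%C by ring. rewrite Hz. ring. }
  apply Hsub, (small_zero _ (8 * M)). intros n.
  pose proof (neumann_cont_supported f Hf) as HN. pose proof (neumann_sum_cont_supported f n Hf) as HS.
  replace (neumann a h f x + volterra a h (neumann a h f) x - f x)%C with
    ((neumann a h f x - neumann_sum a h f (S n) x) +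
      volterra a h (fun y => neumann a h f y + - neumann_sum a h f n y) x)%C.
  2: { rewrite neumann_sum_eq by exact Hf.
       rewrite volterra_plus; [|exact HN | apply cont_supported_opp, HS].
       rewrite volterra_opp by exact HS. ring. }
  eapply Rle_trans; [apply Cmod_triangle|].
  pose proof (neumann_tail f M (S n) Hf HM x) as T1.
  assert (Cmod (volterra a h (fun y => neumann a h f y + - neumann_sum a h f n y)%C x)
    <= 4 * M * (1 / 2) ^ n / 2 * exp (- lam * Rabs x)) as T2.
  { apply HV.
    - apply cont_supported_plus; [exact HN | apply cont_supported_opp, HS].
    - intros y. apply (neumann_tail f M n Hf HM). }
  pose proof (weight_le_1 lam x Hlam). pose proof (exp_pos (- lam * Rabs x)).
  assert (0 < (1 / 2) ^ n) as Hp by (apply pow_lt; lra).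
  assert (0 <= M * (1 / 2) ^ n) by nra.
  replace ((1 / 2) ^ S n) with (1 / 2 * (1 / 2) ^ n) in T1 by reflexivity.
  assert (M * (1 / 2) ^ n * exp (- lam * Rabs x) <= M * (1 / 2) ^ n * 1) as H2
    by (apply Rmult_le_compat_l; assumption).
  lra.
Qed.

Lemma volterra_injective (f : R -> C) : cont_supported r f -> (forall x, (f x + volterra a h f x)%C = 0) ->
  forall x, f x = 0.
Proof.
  intros Hf E. destruct (cont_supported_weight f Hf) as [M [HM0 HM]].
  assert (forall n x, Cmod (f x) <= M * (1 / 2) ^ n * exp (- lam * Rabs x)) as Hn.
  { induction n as [|n IH]; intros x.
    - simpl. rewrite Rmult_1_r. apply HM.
    - replace (f x) with (- volterra a h f x)%C.
      + rewrite Cmod_opp. eapply Rle_trans; [apply (HV f _ Hf IH)|].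
        apply Req_le. simpl. field.
      + replace (f x) with (f x + volterra a h f x - volterra a h f x)%C by ring. rewrite E. ring. }
  intros x. apply (small_zero _ M). intros n. eapply Rle_trans; [apply (Hn n)|].
  pose proof (weight_le_1 lam x Hlam).
  assert (0 < (1 / 2) ^ n) as Hp by (apply pow_lt; lra).
  assert (M * (1 / 2) ^ n * exp (- lam * Rabs x) <= M * (1 / 2) ^ n * 1) as H1
    by (apply Rmult_le_compat_l; [apply Rmult_le_pos; lra | assumption]).
  lra.
Qed.

(** Bootstrapping: R f = f - V (R f), and V gains a derivative. *)
Lemma neumann_diff_bounded (n : nat) : exists A, 0 <= A /\ forall f M, supported_in r f ->
  diff_bounded n f M -> diff_bounded n (neumann a h f) (A * M).
Proof.
  induction n as [|n [A [HA0 HA]]].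
  - exists (4 * exp (lam * r)). split; [pose proof (exp_pos (lam * r)); lra|].
    intros f M Hf [Hc [HM _]].
    assert (cont_supported r f) as Hfs by (split; assumption).
    split; [apply neumann_cont_supported, Hfs | split; [|exact I]].
    intros x.
    pose proof (neumann_tail f _ 0 Hfs (weight_of_sup lam r f M Hlam Hf HM) x) as T.
    simpl in T. replace (neumann a h f x - 0)%C with (neumann a h f x) in T by ring.
    eapply Rle_trans; [exact T|].
    assert (0 <= M) as HM0 by (eapply Rle_trans; [apply Cmod_ge_0 | apply (HM 0)]).
    pose proof (weight_le_1 lam x Hlam). pose proof (exp_pos (lam * r)).
    assert (M * exp (lam * r) * exp (- lam * Rabs x) <= M * exp (lam * r) * 1) as H1
      by (apply Rmult_le_compat_l; [nra | assumption]).
    lra.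
  - destruct (volterra_gain a r Hr0 Hr n h Hh) as [G [HG0 HG]].
    exists (1 + G * A). split; [nra|]. intros f M Hf HfM.
    assert (cont_supported r f) as Hfs by (split; [apply (diff_bounded_ccont _ _ _ HfM) | exact Hf]).
    replace (neumann a h f) with (fun x => f x + - volterra a h (neumann a h f) x)%C.
    2: { extensionality x. rewrite <- (neumann_solves f x Hfs) at 1. ring. }
    replace ((1 + G * A) * M) with (M + G * (A * M)) by ring.
    apply diff_bounded_plus; [exact HfM|]. apply diff_bounded_opp, HG.
    + apply neumann_cont_supported, Hfs.
    + apply HA; [exact Hf | apply diff_bounded_pred, HfM].
Qed.

End Neumann.

(** * The transmutation identity *)

Section Transmutation.

Context (a : R) (q : R -> C) (H : R -> R -> C)
  (Hq : smooth1 a q) (HH : is_H a q H).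

Let qH := source q H.
Let H1 (u v : R) : C := (RtoC (1 / 2) * q u + int_snd qH u v)%C.
Let H2 : R -> R -> C := int_fst qH.

Lemma jet_H1 : jet a H H1.
Proof.
  apply jet_plus; [|apply jet_int_snd, jet_source, Hq].
  apply (jet_mult a H (fun _ _ => RtoC (1 / 2))).
  - apply (jet_fst a H (fun _ => _)), smooth1_const.
  - apply jet_fst, Hq.
Qed.

Lemma H_smooth2 : smooth2 a H.
Proof. apply (jet_smooth2 a q H Hq HH), jet_H. Qed.

Lemma H_antidiag (v : R) : Rabs v < a -> H 0 v = 0.
Proof.
  intros Hv. rewrite (H_eq a q H HH).
  - unfold int_fst. rewrite !CInt_point. ring.
  - unfold dom. rewrite Rabs_R0. lra.
Qed.

(** The coefficient q(u+v) of the source term is q(t) in the variables of the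
    kernel, so it can be moved to the function. *)
Lemma volterra_source (f : R -> C) (x : R) : volterra a qH f x = volterra a H (fun y => q y * f y)%C x.
Proof.
  assert (forall t, (kernel qH t x * f t = kernel H t x * (q t * f t))%C) as E.
  { intros t. unfold kernel, qH, source.
    replace ((t + x) / 2 + (t - x) / 2) with t by field. ring. }
  unfold volterra. f_equal; [|f_equal]; f_equal; extensionality t; apply E.
Qed.

(** Both sides are expanded into boundary terms and a Volterra operator applied to
    [f]: the left one with the second derivative of the kernel in x, the right one
    with the second derivative in t.  Their difference is the mixed derivative of
    [H] in (u,v), which is the source term. *)
Lemma volterra_transmutation (r : R) (f f' f'' : R -> C) : r < a ->
  cont_supported r f -> cont_supported r f' -> cont_supported r f'' ->
  (forall y, cderiv f y (f' y)) -> (forall y, cderiv f' y (f'' y)) ->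
  exists W, (forall x, cderiv (volterra a H f) x (W x)) /\
    forall x, cderiv W x (volterra a H f'' x - volterra a H (fun y => q y * f y) x - q x * f x)%C.
Proof.
  intros Hr Hf Hf' Hf'' Hd Hd'.
  pose proof (H_partials a q H Hq HH) as HP. fold qH H1 H2 in HP.
  assert (cont_dom a H) as cH by (apply smooth2_cont, H_smooth2).
  assert (smooth2 a H1) as sH1 by (apply (jet_smooth2 a q H Hq HH), jet_H1).
  assert (smooth2 a H2) as sH2
    by (apply (jet_smooth2 a q H Hq HH), jet_int_fst, jet_source, Hq).
  assert (cont_dom a qH) as cS by (apply (source_cont a q H Hq HH)).
  pose proof (smooth2_cont _ _ sH1) as cH1. pose proof (smooth2_cont _ _ sH2) as cH2.
  destruct sH1 as [H11 H12 _ P1 s11 _]. destruct sH2 as [H21 H22 _ P2 _ s22].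
  apply smooth2_cont in s11. apply smooth2_cont in s22.
  (* the mixed second derivatives are both the source term, by the equation itself *)
  assert (partials a H1 H11 qH) as Q1.
  { intros u v Huv. split; [apply P1, Huv|]. eapply cderiv_eq.
    - apply cderiv_plus; [apply cderiv_const|]. apply (int_snd_cderiv_2 a qH cS), Huv.
    - ring. }
  assert (partials a H2 qH H22) as Q2.
  { intros u v Huv. split; [|apply P2, Huv]. apply (int_fst_cderiv_1 a qH); assumption. }
  assert (forall c d : C, partials a (fun u v => c * H1 u v + d * H2 u v)%C
    (fun u v => c * H11 u v + d * qH u v)%C (fun u v => c * qH u v + d * H22 u v)%C) as Q.
  { intros c d u v Huv. destruct (Q1 u v Huv) as [A1 A2]. destruct (Q2 u v Huv) as [B1 B2].
    split; (eapply cderiv_eq; [apply cderiv_plus; apply cderiv_mult;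
      [apply cderiv_const | eassumption | apply cderiv_const | eassumption]
      | cbv beta; ring]). }
  set (m := dminus H1 H2). set (p := dplus H1 H2).
  pose proof (Q (RtoC (1 / 2)) (RtoC (- (1 / 2)))) as Qm.
  pose proof (Q (RtoC (1 / 2)) (RtoC (1 / 2))) as Qp.
  set (m1 := fun u v => (RtoC (1 / 2) * H11 u v + RtoC (- (1 / 2)) * qH u v)%C) in Qm.
  set (m2 := fun u v => (RtoC (1 / 2) * qH u v + RtoC (- (1 / 2)) * H22 u v)%C) in Qm.
  set (p1 := fun u v => (RtoC (1 / 2) * H11 u v + RtoC (1 / 2) * qH u v)%C) in Qp.
  set (p2 := fun u v => (RtoC (1 / 2) * qH u v + RtoC (1 / 2) * H22 u v)%C) in Qp.
  assert (cont_dom a m) as cm by (apply cont_dom_lincomb; assumption).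
  assert (cont_dom a p) as cp by (apply cont_dom_lincomb; assumption).
  assert (cont_dom a m1) as cm1 by (apply cont_dom_lincomb; assumption).
  assert (cont_dom a m2) as cm2 by (apply cont_dom_lincomb; assumption).
  assert (cont_dom a p1) as cp1 by (apply cont_dom_lincomb; assumption).
  assert (cont_dom a p2) as cp2 by (apply cont_dom_lincomb; assumption).
  exists (fun x => - (H x 0%R * f x) + volterra a m f x)%C. split.
  - intros x. eapply cderiv_eq; [apply (volterra_cderiv a r Hr H H1 H2); assumption|].
    fold m. destruct (Rle_lt_dec (Rabs x) r) as [Hx | Hx].
    + rewrite H_antidiag by (rewrite Rabs_Ropp; lra). ring.
    + rewrite (proj2 Hf (- x)) by (rewrite Rabs_Ropp; exact Hx). ring.
  - intros x.
    assert (cderiv (fun x => H x 0%R * f x)%C x (H1 x 0%R * f x + H x 0%R * f' x)%C) as D1.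
    { apply (mult_cderiv a r Hr (fun x => H x 0) (fun x => H1 x 0)); [|apply Hf|exact Hd].
      intros y Hy. apply HP. unfold dom. rewrite Rabs_R0. apply interval_Rabs in Hy. lra. }
    eapply cderiv_eq.
    + apply cderiv_plus; [apply cderiv_opp, D1|].
      apply (volterra_cderiv a r Hr m m1 m2); assumption.
    + rewrite (volterra_by_parts a r Hr H H1 H2 f' f'' x) by assumption.
      fold p. rewrite (volterra_by_parts a r Hr p p1 p2 f f' x) by assumption.
      assert (volterra a (dplus p1 p2) f x = (volterra a (dminus m1 m2) f x + volterra a qH f x)%C) as E.
      { pose proof (volterra_lin_kernel a r Hr 1 1 (dminus m1 m2) qH f x) as E.
        rewrite !Cmult_1_l in E. rewrite <- E; [|apply cont_dom_lincomb; assumption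
          | exact cS | exact Hf].
        f_equal. extensionality u. extensionality v.
        unfold dplus, dminus, p1, p2, m1, m2.
        apply C_ext; simpl; unfold Re, Im; field. }
      rewrite E, volterra_source.
      assert (H1 x 0 = RtoC (1 / 2) * q x)%C as E1.
      { unfold H1, int_snd. rewrite CInt_point. ring. }
      assert (H2 0 (- x) = 0) as E2 by (unfold H2, int_fst; apply CInt_point).
      assert ((H 0%R (- x)%R * f' (- x)%R)%C = 0) as E3.
      { destruct (Rle_lt_dec (Rabs x) r) as [Hx | Hx].
        - rewrite H_antidiag by (rewrite Rabs_Ropp; lra). ring.
        - rewrite (proj2 Hf' (- x)) by (rewrite Rabs_Ropp; exact Hx). ring. }
      rewrite E3. unfold p, m, dplus, dminus. rewrite E1, E2.
      set (Y := volterra a (fun u v => _) f x). set (Z := volterra a H _ x).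
      generalize (H2 x 0) (H1 0 (- x)) (f x) (f (- x)) (f' x) (q x) (H x 0) Y Z.
      intros c1 c2 c3 c4 c5 c6 c7 c8 c9.
      apply C_ext; simpl; unfold Re, Im; field.
Qed.

End Transmutation.

(** * Operators on test functions *)

Section TestFunctions.

Context (a : R) (q : R -> C) (H : R -> R -> C)
  (Hq : smooth1 a q) (HH : is_H a q H).

Definition Tadj (f : R -> C) (x : R) : C := (f x + volterra a H f x)%C.

Let sH : smooth2 a H := H_smooth2 a q H Hq HH.

Lemma test_cont_supported (r : R) (f : R -> C) : 0 < r -> test a f -> supported_in r f -> cont_supported r f.
Proof.
  intros Hr Ht Hf. destruct (diff_bounded_of_test 0 a r f Hr Ht Hf) as [M HM].
  split; [apply (diff_bounded_ccont _ _ _ HM) | exact Hf].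
Qed.

Lemma Tadj_diff_bounded (r : R) (n : nat) : 0 < r < a ->
  exists A, 0 <= A /\ forall f M, supported_in r f -> diff_bounded n f M -> diff_bounded n (Tadj f) (A * M).
Proof.
  intros [Hr0 Hr]. destruct (volterra_diff_bounded a r Hr0 Hr n H sH) as [A [HA0 HA]].
  exists (1 + A). split; [lra|]. intros f M Hf HfM.
  replace ((1 + A) * M) with (M + A * M) by ring.
  apply diff_bounded_plus; [exact HfM | apply HA; assumption].
Qed.

Lemma Tadj_supported (r : R) (f : R -> C) : r < a -> supported_in r f -> supported_in r (Tadj f).
Proof.
  intros Hr Hf x Hx. unfold Tadj. rewrite (volterra_zero a r Hr H f x Hf Hx), (Hf x Hx). ring.
Qed.

Lemma contraction (r : R) : 0 < r < a ->
  exists lam, 0 < lam /\ forall f M, cont_supported r f ->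
    (forall x, Cmod (f x) <= M * exp (- lam * Rabs x)) ->
    forall x, Cmod (volterra a H f x) <= M / 2 * exp (- lam * Rabs x).
Proof.
  intros [Hr0 Hr]. apply (volterra_contraction a r Hr H Hr0), smooth2_cont, sH.
Qed.

Lemma neumann_supported (r : R) (f : R -> C) : 0 < r < a -> cont_supported r f ->
  cont_supported r (neumann a H f).
Proof.
  intros Hr Hf. destruct (contraction r Hr) as [lam [Hlam HV]].
  apply (neumann_cont_supported a r (proj1 Hr) (proj2 Hr) H sH lam Hlam HV), Hf.
Qed.

(** What is needed of an operator on functions for its transpose to be a
    continuous linear operator on distributions. *)
Definition test_operator (P : (R -> C) -> R -> C) : Prop :=
  (forall r f, 0 < r < a -> cont_supported r f -> supported_in r (P f)) /\
  (forall r n, 0 < r < a -> exists A, 0 <= A /\ forall f M, supported_in r f ->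
     diff_bounded n f M -> diff_bounded n (P f) (A * M)) /\
  (forall c f g, test a f -> test a g ->
     P (fun x => c * f x + g x)%C = fun x => (c * P f x + P g x)%C).

Lemma test_common (f g : R -> C) : test a f -> test a g ->
  exists r, 0 < r < a /\ supported_in r f /\ supported_in r g.
Proof.
  intros [_ [r [Hr Hf]]] [_ [s [Hs Hg]]]. exists (Rmax r s).
  repeat split.
  - apply Rlt_le_trans with r; [lra | apply Rmax_l].
  - apply Rmax_lub_lt; lra.
  - intros x Hx. apply Hf. pose proof (Rmax_l r s). lra.
  - intros x Hx. apply Hg. pose proof (Rmax_r r s). lra.
Qed.

Lemma test_lincomb (c : C) (f g : R -> C) : test a f -> test a g ->
  test a (fun x => c * f x + g x)%C.
Proof.
  intros Hf Hg. destruct (test_common f g Hf Hg) as [r [Hr [Sf Sg]]].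
  apply (test_of_diff_bounded a r); [exact Hr | |].
  - intros x Hx. rewrite (Sf x Hx), (Sg x Hx). ring.
  - intros n. destruct (diff_bounded_of_test n a r f (proj1 Hr) Hf Sf) as [M HM].
    destruct (diff_bounded_of_test n a r g (proj1 Hr) Hg Sg) as [N HN].
    destruct (mult_diff_bounded a r (proj1 Hr) (proj2 Hr) n (fun _ => c) (smooth1_const a c))
      as [A [_ HA]].
    eexists. apply diff_bounded_plus; [apply HA|]; eassumption.
Qed.

Lemma Tadj_test_operator : test_operator Tadj.
Proof.
  split; [|split].
  - intros r f Hr Hf. apply Tadj_supported; [apply Hr | apply Hf].
  - intros r n Hr. apply Tadj_diff_bounded, Hr.
  - intros c f g Hf Hg. destruct (test_common f g Hf Hg) as [r [Hr [Sf Sg]]].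
    extensionality x. unfold Tadj.
    rewrite (volterra_lin_fun a r (proj2 Hr) H c f g x (smooth2_cont _ _ sH));
      [ring | |]; apply test_cont_supported; tauto.
Qed.

Lemma test_operator_test (P : (R -> C) -> R -> C) (f : R -> C) :
  test_operator P -> test a f -> test a (P f).
Proof.
  intros [PS [PB _]] Hf. destruct (Hf) as [_ [r [Hr Sf]]].
  apply (test_of_diff_bounded a r); [exact Hr | |].
  - apply PS; [exact Hr | apply test_cont_supported; tauto].
  - intros n. destruct (diff_bounded_of_test n a r f (proj1 Hr) Hf Sf) as [M HM].
    destruct (PB r n Hr) as [A [_ HA]]. exists (A * M). apply HA; assumption.
Qed.

Lemma Tadj_neumann (f : R -> C) : test a f -> Tadj (neumann a H f) = f.
Proof.
  intros Hf. destruct (Hf) as [_ [r [Hr Sf]]].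
  destruct (contraction r Hr) as [lam [Hlam HV]]. extensionality x.
  apply (neumann_solves a r (proj1 Hr) (proj2 Hr) H sH lam Hlam HV), test_cont_supported; tauto.
Qed.

Lemma Tadj_injective (r : R) (f g : R -> C) : 0 < r < a -> cont_supported r f -> cont_supported r g ->
  (forall x, Tadj f x = Tadj g x) -> f = g.
Proof.
  intros Hr Hf Hg E. destruct (contraction r Hr) as [lam [Hlam HV]].
  extensionality x.
  replace (f x) with (- (1) * g x + f x + g x)%C by ring.
  rewrite (volterra_injective a r (proj1 Hr) H lam Hlam HV (fun x => - (1) * g x + f x)%C).
  - ring.
  - split.
    + intros y. apply ccont_plus; [apply ccont_mult|]; [apply ccont_const | apply Hg | apply Hf].
    + intros y Hy. rewrite (proj2 Hg y Hy), (proj2 Hf y Hy). ring.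
  - intros y. rewrite (volterra_lin_fun a r (proj2 Hr) H) by (try apply smooth2_cont; assumption).
    specialize (E y). unfold Tadj in E.
    replace (- (1) * g y + f y + (- (1) * volterra a H g y + volterra a H f y))%C with
      ((f y + volterra a H f y) - (g y + volterra a H g y))%C by ring.
    rewrite E. ring.
Qed.

Lemma neumann_test_operator : test_operator (neumann a H).
Proof.
  assert (forall r n, 0 < r < a -> exists A, 0 <= A /\ forall f M, supported_in r f ->
     diff_bounded n f M -> diff_bounded n (neumann a H f) (A * M)) as HB.
  { intros r n Hr. destruct (contraction r Hr) as [lam [Hlam HV]].
    apply (neumann_diff_bounded a r (proj1 Hr) (proj2 Hr) H sH lam Hlam HV). }
  split; [|split; [exact HB|]].
  - intros r f Hr Hf. apply neumann_supported; assumption.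
  - intros c f g Hf Hg. destruct (test_common f g Hf Hg) as [r [Hr [Sf Sg]]].
    assert (cont_supported r f) as Cf by (apply test_cont_supported; tauto).
    assert (cont_supported r g) as Cg by (apply test_cont_supported; tauto).
    pose proof (test_lincomb c f g Hf Hg) as Hfg.
    assert (cont_supported r (fun x => c * f x + g x)%C) as Cfg.
    { apply test_cont_supported; [apply Hr | exact Hfg|].
      intros x Hx. rewrite (Sf x Hx), (Sg x Hx). ring. }
    pose proof (neumann_supported r f Hr Cf) as Nf.
    pose proof (neumann_supported r g Hr Cg) as Ng.
    apply (Tadj_injective r); [exact Hr | apply neumann_supported; assumption | |].
    + split.
      * intros y. apply ccont_plus; [apply ccont_mult|];
          [apply ccont_const | apply Nf | apply Ng].
      * intros y Hy. rewrite (proj2 Nf y Hy), (proj2 Ng y Hy). ring.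
    + intros x. rewrite (Tadj_neumann _ Hfg).
      pose proof (equal_f (Tadj_neumann f Hf) x) as Ef.
      pose proof (equal_f (Tadj_neumann g Hg) x) as Eg.
      rewrite <- Ef, <- Eg. unfold Tadj. rewrite (volterra_lin_fun a r (proj2 Hr) H) by (try apply smooth2_cont; assumption).
      ring.
Qed.

Lemma neumann_T (f : R -> C) : test a f -> neumann a H (Tadj f) = f.
Proof.
  intros Hf. destruct (Hf) as [_ [r [Hr Sf]]].
  pose proof (test_operator_test Tadj f Tadj_test_operator Hf) as HTf.
  assert (cont_supported r (Tadj f)) as CT.
  { apply test_cont_supported; [apply Hr | exact HTf | apply Tadj_supported; [apply Hr | exact Sf]]. }
  apply (Tadj_injective r); [exact Hr | apply neumann_supported; assumption
    | apply test_cont_supported; tauto |].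
  intros x. rewrite (Tadj_neumann _ HTf). reflexivity.
Qed.

Lemma Tadj_transmutation (f : R -> C) : test a f ->
  test a (CDerive (CDerive f)) /\ test a (fun x => q x * f x)%C /\
  CDerive (CDerive (Tadj f)) =
    fun x => (- (1) * Tadj (fun y => q y * f y)%C x + Tadj (CDerive (CDerive f)) x)%C.
Proof.
  intros Hf. destruct (Hf) as [Hs [r [Hr Sf]]].
  assert (forall g : R -> C, test a g -> supported_in r g ->
    (forall y, cderiv g y (CDerive g y)) /\ test a (CDerive g) /\ supported_in r (CDerive g))
    as HD.
  { intros g Hg Sg.
    assert (forall y, cderiv g y (CDerive g y)) as Hd.
    { intros y. apply ex_derive_cderiv, (proj1 Hg 0%nat y I). }
    assert (supported_in r (CDerive g)) as Sg' by (eapply cderiv_supported; eassumption).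
    split; [exact Hd|]. split; [|exact Sg'].
    split; [apply smooth_on_tail, Hg | exists r; split; assumption]. }
  destruct (HD f Hf Sf) as [D1 [Hf' Sf']]. destruct (HD _ Hf' Sf') as [D2 [Hf'' Sf'']].
  split; [exact Hf''|]. split.
  - apply (test_of_diff_bounded a r); [exact Hr | apply mult_supported, Sf |].
    intros n. destruct (diff_bounded_of_test n a r f (proj1 Hr) Hf Sf) as [M HM].
    destruct (mult_diff_bounded a r (proj1 Hr) (proj2 Hr) n q Hq) as [A [_ HA]].
    exists (A * M). apply HA; assumption.
  - destruct (volterra_transmutation a q H Hq HH r f (CDerive f) (CDerive (CDerive f)))
      as [W [HW1 HW2]]; try (apply test_cont_supported; tauto); try assumption; [apply Hr|].
    rewrite (CDerive_eq (Tadj f) (fun x => CDerive f x + W x)%C).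
    2: { intros x. apply cderiv_plus; [apply D1 | apply HW1]. }
    rewrite (CDerive_eq _ _ (fun x => cderiv_plus _ _ x _ _ (D2 x) (HW2 x))).
    extensionality x. unfold Tadj. ring.
Qed.

End TestFunctions.

(** * Transposition to distributions *)

Definition transpose (P : (R -> C) -> R -> C) (u : functional) : functional :=
  fun phi => u (P phi).

Lemma transpose_linear (a : R) (P : (R -> C) -> R -> C) :
  test_operator a P -> linear_operator a (transpose P).
Proof.
  intros HP. pose proof HP as [PS [PB PL]]. split; [|split].
  - intros u [Lu Cu]. split.
    + intros c f g Hf Hg. unfold transpose. rewrite PL by assumption.
      apply Lu; apply test_operator_test; assumption.
    + intros r Hr. destruct (Cu r Hr) as [A [N HA]]. destruct (PB r N Hr) as [B [HB0 HB]].
      exists (A * B), N. intros f M Hf Sf HM.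
      rewrite Rmult_assoc. apply HA.
      * apply test_operator_test; assumption.
      * apply PS; [exact Hr | apply (test_cont_supported a); tauto].
      * intros k x Hk. apply (diff_bounded_CDerive_n N); [|exact Hk].
        apply HB; [exact Sf|]. apply smooth_diff_bounded; [apply Hf|].
        intros; apply HM; assumption.
  - intros u v _ _ E f Hf. apply E, test_operator_test; assumption.
  - intros c u v _ _ f Hf. reflexivity.
Qed.

Lemma transpose_continuous (a : R) (P : (R -> C) -> R -> C) :
  test_operator a P -> continuous_operator a (transpose P).
Proof.
  intros HP X F FF v u _ _ Hv f Hf. apply Hv, test_operator_test; assumption.
Qed.

Theorem proposition26
  (a : R) (ha : 0 < a)
  (q : R -> C) (hq : smooth_on (interval a) q)
  (H : R -> R -> C) (hH : is_H a q H) :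
  (forall phi : R -> C, test a phi -> test a (Tsquare a (kernel H) phi)) /\
  linear_operator a (Tdist a (kernel H)) /\
  continuous_operator a (Tdist a (kernel H)) /\
  (exists S : functional -> functional,
     linear_operator a S /\ continuous_operator a S /\
     inverse_operators a (Tdist a (kernel H)) S) /\
  (forall u : functional, distribution a u ->
     deq a
       (fun phi =>
          (dist_derive (dist_derive (Tdist a (kernel H) u)) phi
           - dist_mult q (Tdist a (kernel H) u) phi)%C)
       (Tdist a (kernel H) (dist_derive (dist_derive u)))).
Proof.
  pose proof (smooth_on_smooth1 a q hq) as Hq.
  assert (Tdist a (kernel H) = transpose (Tadj a H)) as ->.
  { extensionality u. extensionality f. unfold Tdist, transpose.
    rewrite Tsquare_volterra. reflexivity. }
  pose proof (Tadj_test_operator a q H Hq hH) as HT.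
  pose proof (neumann_test_operator a q H Hq hH) as HN.
  split; [|split; [|split; [|split]]].
  - intros f Hf. rewrite Tsquare_volterra. apply (test_operator_test a (Tadj a H)); assumption.
  - apply transpose_linear, HT.
  - apply transpose_continuous, HT.
  - exists (transpose (neumann a H)). split; [|split].
    + apply transpose_linear, HN.
    + apply transpose_continuous, HN.
    + intros u _. split; intros f Hf; unfold transpose; f_equal.
      * apply (Tadj_neumann a q H Hq hH), Hf.
      * apply (neumann_T a q H Hq hH), Hf.
  - intros u [Lu _] f Hf.
    destruct (Tadj_transmutation a q H Hq hH f Hf) as [H1 [H2 E]].
    unfold transpose, dist_derive, dist_mult. rewrite E.
    rewrite Lu by (apply (test_operator_test a (Tadj a H)); assumption). ring.
Qed.
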